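(* Let $(A,\phi_{0})$ be a Jacobi algebroid over a manifold $M$, let $\pi\in\Gamma(\Lambda^2A)$ and $\omega\in\Gamma(\Lambda^2A^* )$, and put $\tilde{\pi}=e^{-t}\pi\in\Gamma(\Lambda^2\tilde A)$ and $\tilde{\omega}=e^{t}\omega\in\Gamma(\Lambda^2\tilde A^* )$. Then the pair $(\pi,\omega)$ is a J$\Omega$-structure on $(A,\phi_{0})$ if and only if the pair $(\tilde{\pi},\tilde{\omega})$ is a P$\Omega$-structure on the Lie algebroid $\tilde{A}_{\bar{\phi}_{0}}$ over $M\times\mathbb{R}$.
   Context: Lie algebroids. A Lie algebroid over $M$ is a vector bundle $A\to M$ with a Lie bracket $[\cdot,\cdot]_A$ on $\Gamma(A)$ and a bundle map $\rho_A:A\to TM$ with $[X,fY]_A=f[X,Y]_A+(\rho_A(X)f)Y$. The Schouten bracket on $\Gamma(\Lambda^*A)$ is the unique extension of the Lie bracket with $[f,g]_A=0$, $[X,f]_A=\rho_A(X)f$, $[D_1,D_2\wedge D_3]_A=[D_1,D_2]_A\wedge D_3+(-1)^{(a_1+1)a_2}D_2\wedge[D_1,D_3]_A$, $[D_1,D_2]_A=-(-1)^{(a_1-1)(a_2-1)}[D_2,D_1]_A$ for $D_i\in\Gamma(\Lambda^{a_i}A)$. The differential $d_A$ on $\Gamma(\Lambda^*A^* )$ is the usual Lie algebroid differential: $(d_A\omega)(X_0,\dots,X_k)=\sum_i(-1)^i\rho_A(X_i)(\omega(X_0,\dots,\hat X_i,\dots,X_k))+\sum_{i<j}(-1)^{i+j}\omega([X_i,X_j]_A,X_0,\dots,\hat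 X_i,\dots,\hat X_j,\dots,X_k)$. Jacobi algebroids. A Jacobi algebroid $(A,\phi_0)$ is a Lie algebroid $A$ with $\phi_0\in\Gamma(A^* )$, $d_A\phi_0=0$. For $D_i\in\Gamma(\Lambda^{a_i}A)$, $[D_1,D_2]_{A,\phi_0}:=[D_1,D_2]_A+(a_1-1)D_1\wedge\iota_{\phi_0}D_2-(-1)^{a_1+1}(a_2-1)\iota_{\phi_0}D_1\wedge D_2$, and $d_{A,\phi_0}\omega:=d_A\omega+\phi_0\wedge\omega$ on $\Gamma(\Lambda^*A^* )$. A Jacobi structure on $(A,\phi_0)$ is $\pi\in\Gamma(\Lambda^2A)$ with $[\pi,\pi]_{A,\phi_0}=0$; a Poisson structure on a Lie algebroid $A$ is $\pi\in\Gamma(\Lambda^2A)$ with $[\pi,\pi]_A=0$. Notation. $\langle\pi^\sharp\xi,\eta\rangle:=\pi(\xi,\eta)$ and $\langle\omega^\flat X,Y\rangle:=\omega(X,Y)$. J$\Omega$- and P$\Omega$-structures. A pair $(\pi,\omega)$ with $\pi\in\Gamma(\Lambda^2A)$, $\omega\in\Gamma(\Lambda^2A^* )$ is a J$\Omega$-structure on $(A,\phi_0)$ if $\pi$ is a Jacobi structure and both $\omega$ and $\omega_N$ are $d_{A,\phi_0}$-closed, where $N:=\pi^\sharp\circ\omega^\flat$ and $\omega_N\in\Gamma(\Lambda^2A^* )$ is characterized by $\omega_N^\flat=\omega^\flat\circ N$. A pair $(\pi,\omega)$ is a P$\Omega$-structure on a Lie algebroid $A$ if $\pi$ is Poisson and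 both $\omega$ and $\omega_N$ (with the same $N$, $\omega_N$) are $d_A$-closed. The Lie algebroid $\tilde A_{\bar\phi_0}$. $\tilde A:=A\times\mathbb{R}$ is a vector bundle over $M\times\mathbb{R}$, with $t$ the standard coordinate on $\mathbb{R}$; its sections are identified with time-dependent sections of $A$, and operations of $A$ are applied pointwise in $t$. $\tilde A_{\bar\phi_0}$ is $\tilde A$ with bracket $[\tilde X,\tilde Y\bar{]}_A^{\phi_0}:=[\tilde X,\tilde Y]_A+\langle\phi_0,\tilde X\rangle\frac{\partial\tilde Y}{\partial t}-\langle\phi_0,\tilde Y\rangle\frac{\partial\tilde X}{\partial t}$ and anchor $\bar\rho_A^{\phi_0}(\tilde X):=\rho_A(\tilde X)+\langle\phi_0,\tilde X\rangle\frac{\partial}{\partial t}$. *)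

(* Defs.v *)
From HB Require Import structures.
From mathcomp Require Import all_boot all_order all_algebra.
From mathcomp Require Import all_classical all_reals all_analysis.

Set Implicit Arguments.
Unset Strict Implicit.
Unset Printing Implicit Defensive.

Import Order.TTheory GRing.Theory Num.Theory.
Import numFieldNormedType.Exports.
Local Open Scope classical_set_scope.
Local Open Scope ring_scope.

(** * Smooth manifolds *)

Section Smooth.
Context {R : realType}.

(* For [U] open and [V] finite-dimensional this is the usual class C^k: all
   iterated directional derivatives up to order [k] exist and are continuous. *)
Fixpoint Ck_on {V : normedModType R} (k : nat) (U : set V) (f : V -> R) : Prop :=
  (forall u, U u -> {for u, continuous f}) /\
  if k is k'.+1 then
    forall v, (forall u, U u -> derivable f u v) /\ Ck_on k' U ('D_v f)
  else True.

Definition smooth_on {V : normedModType R} (U : set V) (f : V -> R) : Prop :=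
  forall k, Ck_on k U f.

(* [chart_fun] and [chart_inv] are total functions; only their values on
   [chart_dom] and on its image are meaningful. *)
Record chart (T : topologicalType) (n : nat) := Chart {
  chart_dom : set T;
  chart_fun :> T -> 'rV[R]_n;
  chart_inv : 'rV[R]_n -> T }.

Definition is_chart (T : topologicalType) n (c : chart T n) : Prop :=
  [/\ open (chart_dom c), open (c @` chart_dom c),
      forall x, chart_dom c x -> chart_inv c (c x) = x,
      forall x, chart_dom c x -> {for x, continuous c} &
      forall u, (c @` chart_dom c) u -> {for u, continuous (chart_inv c)}].

Definition smooth_transition (T : topologicalType) n (c d : chart T n) : Prop :=
  forall i, smooth_on (c @` (chart_dom c `&` chart_dom d))
                      (fun u => d (chart_inv c u) 0 i).

Record manifold (n : nat) := Manifold {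
  manifold_space :> topologicalType;
  atlas : set (chart manifold_space n);
  manifold_hausdorff : hausdorff_space manifold_space;
  manifold_countable : @second_countable manifold_space;
  atlas_chart : forall c, atlas c -> is_chart c;
  atlas_cover : forall x, exists2 c, atlas c & chart_dom c x;
  atlas_transition : forall c d, atlas c -> atlas d -> smooth_transition c d }.

Arguments atlas {n} M _ : rename.

(* The set [U] is meant to be open. *)
Definition smooth_fun n (M : manifold n) (U : set M) (f : M -> R) : Prop :=
  forall c, atlas M c ->
    smooth_on (c @` (chart_dom c `&` U)) (fun u => f (chart_inv c u)).

End Smooth.

Arguments chart R T n : clear implicits.
Arguments manifold R n : clear implicits.
Arguments atlas {R n} M _ : rename.

(** * The manifold M x R *)

Section TimesLine.
Context {R : realType}.

Lemma Ck_on_sub (V : normedModType R) k (U W : set V) (f : V -> R) :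
  W `<=` U -> Ck_on k U f -> Ck_on k W f.
Proof.
elim: k f => [|k IH] f WU [fc fd]; split => //; first by move=> u /WU /fc.
  by move=> u /WU /fc.
by move=> v; have [dv cv] := fd v; split; [move=> u /WU /dv | exact: IH].
Qed.

Lemma Ck_on_lin (V W : normedModType R) (l : V -> W) k (U : set W) f :
  linear l -> continuous l -> Ck_on k U f -> Ck_on k (l @^-1` U) (f \o l).
Proof.
move=> ll lc; elim: k f => [|k IH] f [fc fd]; split => //.
- by move=> u Uu; apply: continuous_comp; [exact: lc | exact: fc].
- by move=> u Uu; apply: continuous_comp; [exact: lc | exact: fc].
have quotE u v :
    (fun h : R => h^-1 *: (((f \o l) \o shift u) (h *: v) - (f \o l) u))
    = (fun h : R => h^-1 *: ((f \o shift (l u)) (h *: l v) - f (l u))).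
  by apply/funext => h /=; rewrite ll.
move=> v; have [dv cv] := fd (l v); split.
  by move=> u /dv; rewrite /derivable quotE.
have -> : 'D_v (f \o l) = 'D_(l v) f \o l.
  by apply/funext => u; rewrite /derive quotE.
exact: IH.
Qed.

Lemma Ck_on_cst (V : normedModType R) k (U : set V) (a : R) :
  Ck_on k U (cst a).
Proof.
elim: k a => [|k IH] a; split => //; try by move=> u _; exact: cst_continuous.
move=> v; split; first by move=> u _; exact: derivable_cst.
have -> : 'D_v (cst a : V -> R) = cst 0.
  by apply/funext => u; rewrite derive_cst.
exact: IH.
Qed.

Lemma Ck_on_id k (U : set R) : Ck_on k U (id : R -> R).
Proof.
case: k => [|k]; split => //; try by move=> u _; exact: cvg_id.
move=> v; split; first by move=> u _; exact: derivable_id.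
have -> : 'D_v (id : R -> R) = cst v.
  by apply/funext => u; rewrite derive_id.
exact: Ck_on_cst.
Qed.

Lemma second_countable_line : @second_countable R.
Proof.
exists [set [set` `]ratr q.1, ratr q.2[%R] | q in [set: rat * rat]].
  exact: (sub_countable (card_image_le _ _)).
split; first by move=> _ [q _ <-]; exact: itv_open.
move=> x A /nbhs_ballP[e /= e0 xeA].
have [p /itvP pe] : exists q : rat, ratr q \in `]x - e, x[%R.
  by apply: rat_in_itvoo; rewrite ltrBlDr ltrDl.
have [q /itvP qe] : exists q : rat, ratr q \in `]x, x + e[%R.
  by apply: rat_in_itvoo; rewrite ltrDl.
exists [set` `]ratr p, ratr q[%R].
  by split; [exists (p, q) | rewrite /= in_itv/= pe qe].
move=> y; rewrite /= in_itv/= => /andP[py yq]; apply: xeA.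
rewrite /ball/= ltr_distlC (lt_trans _ py) ?(lt_trans yq) ?qe//.
by rewrite pe.
Qed.

Lemma second_countable_prod (S T : topologicalType) :
  @second_countable S -> @second_countable T ->
  @second_countable (S * T)%type.
Proof.
move=> [B cB [oB nB]] [C cC [oC nC]].
exists [set D.1 `*` D.2 | D in B `*` C].
  apply: (sub_countable (card_image_le _ _)); exact: countableX.
split=> [_ [D [/= /oB oD1 /oC oD2] <-]|[x y] A [[P Q] /= [xP yQ] PQA]].
  rewrite openE => -[x y] [/= Dx Dy]; exists (D.1, D.2) => //=.
  by split; apply: open_nbhs_nbhs.
have [U [BU Ux] UP] := nB x _ xP; have [V [CV Vy] VQ] := nC y _ yQ.
exists (U `*` V); first by split => //; exists (U, V).
by move=> [u v] [/= /UP Pu /VQ Qv]; exact: PQA.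
Qed.

Lemma hausdorff_prod (S T : topologicalType) :
  hausdorff_space S -> hausdorff_space T -> hausdorff_space (S * T)%type.
Proof.
move=> hS hT [x y] [x' y'] xy; congr pair.
- apply: hS => U V xU xV.
  have nU : nbhs (x, y) (U `*` setT).
    by exists (U, setT) => //; split => //; exact: filterT.
  have nV : nbhs (x', y') (V `*` setT).
    by exists (V, setT) => //; split => //; exact: filterT.
  by have [[u v] [[/= Uu _] [/= Vu _]]] := xy _ _ nU nV; exists u.
- apply: hT => U V yU yV.
  have nU : nbhs (x, y) (setT `*` U).
    by exists (setT, U) => //; split => //; exact: filterT.
  have nV : nbhs (x', y') (setT `*` V).
    by exists (setT, V) => //; split => //; exact: filterT.
  by have [[u v] [[/= _ Uv] [/= _ Vv]]] := xy _ _ nU nV; exists v.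
Qed.

Context {n : nat}.

Definition chart_times_line (T : topologicalType) (c : chart R T n) :
    chart R (T * R)%type (n + 1) :=
  {| chart_dom := chart_dom c `*` setT;
     chart_fun p := row_mx (c p.1) (\row__ p.2);
     chart_inv u := (chart_inv c (lsubmx u), rsubmx u 0 0) |}.

Lemma chart_times_line_image (T : topologicalType) (c : chart R T n) U :
  chart_times_line c @` (U `*` setT) = lsubmx @^-1` (c @` U).
Proof.
apply/seteqP; split=> [_ [[x t] [/= Ux _] <-]|u [x Ux xu]] /=.
  by rewrite row_mxKl; exists x.
exists (x, rsubmx u 0 0) => //=; rewrite xu -[RHS]hsubmxK; congr row_mx.
by apply/rowP => i; rewrite mxE ord1.
Qed.

Lemma is_chart_times_line (T : topologicalType) (c : chart R T n) :
  is_chart c -> is_chart (chart_times_line c).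
Proof.
case=> od oi cK cc ic; split.
- rewrite openE => -[x t] [/= dx _]; exists (chart_dom c, setT) => //=.
  by split; [exact: open_nbhs_nbhs | exact: filterT].
- rewrite chart_times_line_image; apply: open_comp => // u _.
  exact: continuous_lsubmx.
- by move=> [x t] [/= dx _]; rewrite row_mxKl row_mxKr cK// mxE.
- move=> [x t] [/= dx _] A [P nP PA].
  exists (c @^-1` [set u | forall j, P 0 (lshift 1 j) (u 0 j)],
          P 0 (rshift n 0)) => /=.
    split; last by have := nP 0 (rshift n 0); rewrite row_mxEr mxE.
    apply: (cc _ dx); exists (fun _ j => P 0 (lshift 1 j)).
      by move=> i j; have := nP 0 (lshift 1 j); rewrite row_mxEl ord1.
    by move=> u + j; apply.
  move=> [y s] [/= yP sP]; apply: PA => i j; rewrite ord1.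
  by case: (split_ordP j) => k ->; rewrite ?row_mxEl ?row_mxEr ?mxE ?ord1.
- rewrite chart_times_line_image => u ui.
  have c1 := continuous_comp (@continuous_lsubmx _ _ _ _ u) (ic _ ui).
  have c2 := continuous_comp (@continuous_rsubmx _ _ _ _ u)
                             (@coord_continuous _ _ _ 0 0 _).
  exact: (@cvg_pair _ _ _ (nbhs u) _ _ _ _ _ _ _ c1 c2).
Qed.

Lemma smooth_times_line (T : topologicalType) (c : chart R T n) (U : set T)
    (f : T -> R) :
  smooth_on (c @` U) (f \o chart_inv c) ->
  smooth_on (chart_times_line c @` (U `*` setT))
    (fun u => f (chart_inv (chart_times_line c) u).1).
Proof.
move=> sf k; rewrite chart_times_line_image.
apply: (@Ck_on_lin _ _ lsubmx k _ (f \o chart_inv c)) => //.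
  exact: linearP.
exact: continuous_lsubmx.
Qed.

Lemma transition_times_line (T : topologicalType) (c d : chart R T n) :
  smooth_transition c d ->
  smooth_transition (chart_times_line c) (chart_times_line d).
Proof.
move=> cd i /=.
have -> : chart_dom c `*` [set: R] `&` chart_dom d `*` [set: R]
    = (chart_dom c `&` chart_dom d) `*` [set: R].
  by apply/seteqP; split=> [p [[? _] [? _]]|p [[? ?] _]].
case: (split_ordP i) => j ->.
- rewrite (_ : (fun _ => _) = fun u => d (chart_inv c (lsubmx u)) 0 j).
    exact: (@smooth_times_line _ c _ (fun x => d x 0 j) (cd j)).
  by apply/funext => u; rewrite row_mxEl.
- rewrite (_ : (fun _ => _) = fun u => rsubmx u 0 0); last first.
    by apply/funext => u; rewrite row_mxEr mxE.
  move=> k; apply: (@Ck_on_sub _ _ setT) => //.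
  apply: (@Ck_on_lin _ _ (fun u : 'rV_(n + 1) => rsubmx u 0 0) k setT id).
  + by move=> a u v; rewrite !mxE.
  + move=> u; exact: continuous_comp (@continuous_rsubmx _ _ _ _ u)
                                     (@coord_continuous _ _ _ 0 0 _).
  + exact: Ck_on_id.
Qed.

Lemma times_line_cover (M : manifold R n) (p : M * R) :
  exists2 c, (@chart_times_line M @` atlas M) c & chart_dom c p.
Proof.
have [c Ac cx] := atlas_cover p.1.
by exists (chart_times_line c) => //; exists c.
Qed.

Program Definition times_line (M : manifold R n) : manifold R (n + 1) :=
  {| manifold_space := (M * R)%type;
     atlas := @chart_times_line M @` atlas M |}.
Next Obligation.
by move=> M; apply: hausdorff_prod;
  [exact: manifold_hausdorff | exact: Rhausdorff].
Qed.
Next Obligation.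
by move=> M; apply: second_countable_prod;
  [exact: manifold_countable | exact: second_countable_line].
Qed.
Next Obligation.
by move=> M _ [c Ac <-]; apply/is_chart_times_line/atlas_chart.
Qed.
Next Obligation. by move=> M x; exact: times_line_cover. Qed.
Next Obligation.
move=> M _ _ [c Ac <-] [d Ad <-]; apply: transition_times_line.
exact: atlas_transition.
Qed.

End TimesLine.

(** * Vector bundles *)

(* A bundle is given by its fibres together with a family of local frames
   [e_1, ..., e_r] and their dual coframes, whose transition functions are
   smooth; this determines the smooth structure of the total space. *)
Record local_frame (R : realType) (T : Type) (E : T -> vectType R) (r : nat) :=
  LocalFrame {
    frame_dom : set T;
    frame : 'I_r -> forall x, E x;
    coframe : 'I_r -> forall x, 'Hom(E x, R^o) }.

Section Bundles.
Context {R : realType}.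

Definition is_frame (T : topologicalType) (E : T -> vectType R) r
    (e : local_frame E r) : Prop :=
  open (frame_dom e) /\
  forall x, frame_dom e x ->
    (forall i j, coframe e i x (frame e j x) = (i == j)%:R) /\
    (forall v, v = \sum_i coframe e i x v *: frame e i x).

Record vector_bundle n (M : manifold R n) (r : nat) := VectorBundle {
  fiber :> M -> vectType R;
  frames : set (local_frame fiber r);
  frames_frame : forall e, frames e -> is_frame e;
  frames_cover : forall x, exists2 e, frames e & frame_dom e x;
  frames_transition : forall e f, frames e -> frames f -> forall i j,
    smooth_fun (frame_dom e `&` frame_dom f)
               (fun x => coframe f j x (frame e i x)) }.

Arguments frames {n M r} E _ : rename.

Context {n : nat} {M : manifold R n} {r : nat}.
Implicit Types E : vector_bundle M r.

Definition section E : Type := forall x, E x.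

Definition smooth_section E (X : section E) : Prop :=
  forall e, frames E e -> forall i,
    smooth_fun (frame_dom e) (fun x => coframe e i x (X x)).

Definition dual_frame E (e : local_frame E r) :
    local_frame (fun x => 'Hom(E x, R^o)) r :=
  {| frame_dom := frame_dom e;
     frame := coframe e;
     coframe i x := linfun (fun xi : 'Hom(E x, R^o) => xi (frame e i x)) |}.

Lemma dual_coframeE E (e : local_frame E r) i x xi :
  coframe (dual_frame e) i x xi = xi (frame e i x).
Proof.
pose ev (v : E x) (xi : 'Hom(E x, R^o)) : R^o := xi v.
have ev_linear v : linear (ev v).
  by move=> a f g; rewrite /ev add_lfunE scale_lfunE.
pose l : {linear 'Hom(E x, R^o) -> R^o} :=
  HB.pack (ev (frame e i x)) (GRing.isLinear.Build _ _ _ _ _ (ev_linear _)).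
exact: (lfunE l xi).
Qed.

Program Definition dual_bundle E : vector_bundle M r :=
  {| fiber x := 'Hom(E x, R^o);
     frames := @dual_frame E @` frames E |}.
Next Obligation.
move=> E _ [e Ee <-]; have [oe eP] := frames_frame Ee; split=> // x ex.
have [deltaP sumP] := eP x ex; split=> [i j|xi].
  by rewrite dual_coframeE deltaP eq_sym.
apply/lfunP => v; rewrite sum_lfunE {1}[v]sumP linear_sum.
apply: eq_bigr => i _; rewrite linearZ scale_lfunE dual_coframeE.
exact: mulrC.
Qed.
Next Obligation.
by move=> E x; have [e Ee ex] := frames_cover E x; exists (dual_frame e);
  [exists e|].
Qed.
Next Obligation.
move=> E _ _ [e Ee <-] [f Ef <-] i j /=; rewrite setIC.
rewrite (_ : (fun _ => _) = fun x => coframe e i x (frame f j x)).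
  exact: frames_transition.
by apply/funext => x; exact: dual_coframeE.
Qed.

(** The pullback of a bundle to M x R *)

Definition frame_times_line E (e : local_frame E r) :
    local_frame (fun p : times_line M => E p.1) r :=
  {| frame_dom := frame_dom e `*` setT;
     frame i p := frame e i p.1;
     coframe i p := coframe e i p.1 |}.

Lemma smooth_fun_times_line (U : set M) (f : M -> R) :
  smooth_fun U f ->
  smooth_fun (U `*` setT : set (times_line M)) (fun p => f p.1).
Proof.
move=> sf _ [c Ac <-].
rewrite (_ : _ `&` _ = (chart_dom c `&` U) `*` [set: R]).
  exact: (@smooth_times_line _ _ _ c _ f (sf c Ac)).
by apply/seteqP; split=> [p [[? _] [? _]]|p [[? ?] _]].
Qed.

Program Definition bundle_times_line E : vector_bundle (times_line M) r :=
  {| fiber p := E p.1;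
     frames := @frame_times_line E @` frames E |}.
Next Obligation.
move=> E _ [e Ee <-]; have [oe eP] := frames_frame Ee; split.
  rewrite openE => -[x t] [/= ex _]; exists (frame_dom e, setT) => //=.
  by split; [exact: open_nbhs_nbhs | exact: filterT].
by move=> [x t] [/= ex _]; exact: eP.
Qed.
Next Obligation.
move=> E [x t]; have [e Ee ex] := frames_cover E x.
by exists (frame_times_line e) => //; exists e.
Qed.
Next Obligation.
move=> E _ _ [e Ee <-] [f Ef <-] i j.
have -> : frame_dom (frame_times_line e) `&` frame_dom (frame_times_line f)
    = (frame_dom e `&` frame_dom f) `*` [set: R].
  by apply/seteqP; split=> [p [[? _] [? _]]|p [[? ?] _]].
exact: (smooth_fun_times_line (frames_transition Ee Ef i j)).
Qed.

End Bundles.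

Arguments frames {R n M r} E _ : rename.
Arguments section {R n M r} E.

(** * Exterior algebra *)

(* An element of the exterior algebra of the dual of [V] is encoded by all its
   values on lists of vectors, its component of degree [k] being its restriction
   to lists of length [k].  With this encoding sections of Λ^*E^* form one type
   for all degrees; sections of Λ^*E are the forms on [dual_bundle E]. *)
Section Forms.
Context {R : realType}.

Definition alternating_form (V : lmodType R) (w : seq V -> R) : Prop :=
  (forall s1 s2 a u v, w (s1 ++ (a *: u + v) :: s2)
                       = a * w (s1 ++ u :: s2) + w (s1 ++ v :: s2)) /\
  (forall s, ~~ uniq s -> w s = 0).

(* [shuffle_inv m] is the number of inversions of the shuffle which moves the
   positions selected by [m] to the front. *)
Fixpoint shuffle_inv (m : bitseq) : nat :=
  if m is b :: m' then ((if b then 0 else count id m') + shuffle_inv m')%N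
  else 0%N.

Context {n : nat} {M : manifold R n} {r : nat}.
Implicit Types E : vector_bundle M r.

Definition ext_form E : Type := forall x, seq (E x) -> R.

Definition smooth_form E (w : ext_form E) : Prop :=
  (forall x, alternating_form (w x)) /\
  forall e, frames E e -> forall I : seq 'I_r,
    smooth_fun (frame_dom e) (fun x => w x [seq frame e i x | i <- I]).

(* Γ(Λ^k E^* ) *)
Definition kform E (k : nat) (w : ext_form E) : Prop :=
  smooth_form w /\ forall x s, size s != k -> w x s = 0.

Definition ext_wedge E (w1 w2 : ext_form E) : ext_form E := fun x s =>
  \sum_(m : (size s).-tuple bool)
    (-1) ^+ shuffle_inv m * w1 x (mask m s) * w2 x (mask (map negb m) s).

Definition int_product E (X : section E) (w : ext_form E) : ext_form E :=
  fun x s => w x (X x :: s).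

Definition form0 E (f : M -> R) : ext_form E :=
  fun x s => if s is [::] then f x else 0.

Definition form1 E (xi : section (dual_bundle E)) : ext_form E :=
  fun x s => if s is [:: v] then xi x v else 0.

End Forms.

Arguments ext_form {R n M r} E.
Arguments ext_wedge {R n M r E} w1 w2 x s.
Arguments int_product {R n M r E} X w x s.
Arguments form0 {R n M r E} f x s.
Arguments form1 {R n M r E} xi x s.

(* Γ(Λ^*A) *)
Notation multivector A := (ext_form (dual_bundle A)).

(** * Lie algebroids *)

Section Algebroids.
Context {R : realType} {n : nat} {M : manifold R n} {r : nat}.
Implicit Types A : vector_bundle M r.

(* A section of [A] viewed in Γ(Λ^1 A) through A = A^**. *)
Definition vector1 A (X : section A) : multivector A :=
  fun x s => if s is [:: xi] then (xi : 'Hom(A x, R^o)) (X x) else 0.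

(* T_xM as the space of derivations at [x] of C^∞(M); values on non-smooth
   functions are irrelevant. *)
Definition tangent_vector (x : M) (v : (M -> R) -> R) : Prop :=
  forall f g, smooth_fun setT f -> smooth_fun setT g ->
    (forall a, v (fun y => a * f y + g y) = a * v f + v g) /\
    v (fun y => f y * g y) = f x * v g + g x * v f.

(* Only the values of [bracket] on smooth sections are meaningful. *)
Record algebroid A := Algebroid {
  bracket : section A -> section A -> section A;
  anchor : forall x, A x -> (M -> R) -> R }.
Arguments anchor {A} L x v f : rename.

Record lie_algebroid A (L : algebroid A) : Prop := LieAlgebroid {
  bracket_smooth : forall X Y, smooth_section X -> smooth_section Y ->
    smooth_section (bracket L X Y);
  bracket_linear : forall a X Y Z,
    smooth_section X -> smooth_section Y -> smooth_section Z ->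
    bracket L (fun x => a *: X x + Y x) Z
    = fun x => a *: bracket L X Z x + bracket L Y Z x;
  bracket_skew : forall X Y, smooth_section X -> smooth_section Y ->
    bracket L X Y = fun x => - bracket L Y X x;
  bracket_jacobi : forall X Y Z,
    smooth_section X -> smooth_section Y -> smooth_section Z ->
    forall x, bracket L X (bracket L Y Z) x + bracket L Y (bracket L Z X) x
              + bracket L Z (bracket L X Y) x = 0;
  anchor_tangent : forall x v, tangent_vector x (anchor L x v);
  anchor_linear : forall x a (u v : A x) f, smooth_fun setT f ->
    anchor L x (a *: u + v) f = a * anchor L x u f + anchor L x v f;
  anchor_smooth : forall X f, smooth_section X -> smooth_fun setT f ->
    smooth_fun setT (fun x => anchor L x (X x) f);
  bracket_leibniz : forall X Y f,
    smooth_section X -> smooth_section Y -> smooth_fun setT f ->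
    bracket L X (fun x => f x *: Y x)
    = fun x => f x *: bracket L X Y x + anchor L x (X x) f *: Y x }.

(* [S] is the Schouten bracket of the Lie algebroid; the exponents
   (a1 + 1) (a2 + 1) have the parity of (a1 - 1) (a2 - 1). *)
Record schouten_bracket A (L : algebroid A)
    (S : multivector A -> multivector A -> multivector A) : Prop :=
  SchoutenBracket {
  schouten_smooth : forall D1 D2, smooth_form D1 -> smooth_form D2 ->
    smooth_form (S D1 D2);
  schouten_degree : forall a1 a2 k D1 D2, kform a1 D1 -> kform a2 D2 ->
    (a1 + a2 = k.+1)%N -> kform k (S D1 D2);
  schouten_linear_l : forall a D1 D2 D3,
    smooth_form D1 -> smooth_form D2 -> smooth_form D3 ->
    S (fun x s => a * D1 x s + D2 x s) D3
    = fun x s => a * S D1 D3 x s + S D2 D3 x s;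
  schouten_linear_r : forall a D1 D2 D3,
    smooth_form D1 -> smooth_form D2 -> smooth_form D3 ->
    S D1 (fun x s => a * D2 x s + D3 x s)
    = fun x s => a * S D1 D2 x s + S D1 D3 x s;
  schouten_fun_fun : forall f g, smooth_fun setT f -> smooth_fun setT g ->
    S (form0 f) (form0 g) = form0 (fun=> 0);
  schouten_section_fun : forall X f, smooth_section X -> smooth_fun setT f ->
    S (vector1 X) (form0 f) = form0 (fun x => anchor L x (X x) f);
  schouten_section_section : forall X Y, smooth_section X -> smooth_section Y ->
    S (vector1 X) (vector1 Y) = vector1 (bracket L X Y);
  schouten_leibniz : forall a1 a2 a3 D1 D2 D3,
    kform a1 D1 -> kform a2 D2 -> kform a3 D3 ->
    S D1 (ext_wedge D2 D3)
    = fun x s => ext_wedge (S D1 D2) D3 x s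
                 + (-1) ^+ ((a1 + 1) * a2) * ext_wedge D2 (S D1 D3) x s;
  schouten_skew : forall a1 a2 D1 D2, kform a1 D1 -> kform a2 D2 ->
    S D1 D2 = fun x s => - (-1) ^+ ((a1 + 1) * (a2 + 1)) * S D2 D1 x s }.

(* d_A ω on k+1 sections, for ω of degree k. *)
Definition algebroid_d A (L : algebroid A) (k : nat) (w : ext_form A)
    (X : 'I_k.+1 -> section A) : M -> R := fun x =>
  \sum_(i < k.+1) (-1) ^+ i *
    anchor L x (X i x) (fun y => w y [seq X l y | l <- enum 'I_k.+1 & l != i]) +
  \sum_(i < k.+1) \sum_(j < k.+1 | (i < j)%N) (-1) ^+ (i + j) *
    w x (bracket L (X i) (X j) x ::
         [seq X l x | l <- enum 'I_k.+1 & (l != i) && (l != j)]).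

(* d_{A,φ} ω = d_A ω + φ ∧ ω *)
Definition jacobi_d A (L : algebroid A) (phi : section (dual_bundle A))
    (k : nat) (w : ext_form A) (X : 'I_k.+1 -> section A) : M -> R := fun x =>
  algebroid_d L w X x + ext_wedge (form1 phi) w x [seq X l x | l <- enum 'I_k.+1].

Definition d_closed A (L : algebroid A) (k : nat) (w : ext_form A) : Prop :=
  forall X : 'I_k.+1 -> section A, (forall i, smooth_section (X i)) ->
  forall x, algebroid_d L w X x = 0.

Definition jacobi_d_closed A (L : algebroid A) (phi : section (dual_bundle A))
    (k : nat) (w : ext_form A) : Prop :=
  forall X : 'I_k.+1 -> section A, (forall i, smooth_section (X i)) ->
  forall x, jacobi_d L phi w X x = 0.

Definition jacobi_algebroid A (L : algebroid A)
    (phi : section (dual_bundle A)) : Prop :=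
  [/\ lie_algebroid L, smooth_section phi & d_closed L 1 (form1 phi)].

(* [D1, D2]_{A,φ} for D1, D2 of degrees a1, a2, where S = [ , ]_A. *)
Definition jacobi_bracket A
    (S : multivector A -> multivector A -> multivector A)
    (phi : section (dual_bundle A)) (a1 a2 : nat) (D1 D2 : multivector A) :
    multivector A := fun x s =>
  S D1 D2 x s + (a1%:R - 1) * ext_wedge D1 (int_product phi D2) x s
  - (-1) ^+ (a1 + 1) * (a2%:R - 1) * ext_wedge (int_product phi D1) D2 x s.

Definition jacobi_structure A S (phi : section (dual_bundle A))
    (pi : multivector A) : Prop :=
  kform 2 pi /\ jacobi_bracket S phi 2 2 pi pi = fun _ _ => 0.

Definition poisson_structure A
    (S : multivector A -> multivector A -> multivector A)
    (pi : multivector A) : Prop :=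
  kform 2 pi /\ S pi pi = fun _ _ => 0.

(* The vector π^♯ξ, given by its coordinates in some basis of the fibre;
   [bivector_sharpP] is its characterization <π^♯ξ, η> = π(ξ, η). *)
Definition bivector_sharp A (pi : multivector A) x (xi : 'Hom(A x, R^o)) : A x :=
  \sum_i pi x [:: xi; linfun (coord (vbasis fullv) i : A x -> R^o)]
         *: (vbasis fullv)`_i.

Definition form_flat A (w : ext_form A) x (X : A x) : 'Hom(A x, R^o) :=
  linfun (fun Y => w x [:: X; Y] : R^o).

Definition recursion_op A (pi : multivector A) (w : ext_form A) x (X : A x) : A x :=
  bivector_sharp pi (form_flat w X).

Definition form_N A (pi : multivector A) (w : ext_form A) : ext_form A := fun x s =>
  if s is [:: X; Y] then form_flat w (recursion_op pi w X) Y else 0.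

Definition JOmega_structure A (L : algebroid A) S
    (phi : section (dual_bundle A)) (pi : multivector A) (w : ext_form A) : Prop :=
  [/\ jacobi_structure S phi pi, kform 2 w, jacobi_d_closed L phi 2 w &
      jacobi_d_closed L phi 2 (form_N pi w)].

Definition POmega_structure A (L : algebroid A) S
    (pi : multivector A) (w : ext_form A) : Prop :=
  [/\ poisson_structure S pi, kform 2 w, d_closed L 2 w &
      d_closed L 2 (form_N pi w)].

Lemma form_flatP A (w : ext_form A) x (X Y : A x) : alternating_form (w x) ->
  form_flat w X Y = w x [:: X; Y].
Proof.
move=> [wl _]; pose f (Y : A x) : R^o := w x [:: X; Y].
have f_linear : linear f by move=> a u v; exact: (wl [:: X] [::]).
pose l : {linear A x -> R^o} := HB.pack f (GRing.isLinear.Build _ _ _ _ _ f_linear).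
exact: (lfunE l Y).
Qed.

Lemma bivector_sharpP A (pi : multivector A) x (xi eta : 'Hom(A x, R^o)) :
  alternating_form (pi x) -> eta (bivector_sharp pi xi) = pi x [:: xi; eta].
Proof.
move=> [pl _]; pose f (z : 'Hom(A x, R^o)) : R^o := pi x [:: xi; z].
have f_linear : linear f by move=> a u v; exact: (pl [:: xi] [::]).
pose l : {linear 'Hom(A x, R^o) -> R^o} :=
  HB.pack f (GRing.isLinear.Build _ _ _ _ _ f_linear).
pose dual i := linfun (coord (vbasis (fullv : {vspace A x})) i : _ -> R^o).
have etaE : eta = \sum_(i < \dim (fullv : {vspace A x}))
                    eta (vbasis fullv)`_i *: dual i.
  apply/lfunP => v; rewrite sum_lfunE {1}[v](coord_vbasis (memvf v)) linear_sum.
  apply: eq_bigr => i _; rewrite linearZ scale_lfunE lfunE/=; exact: mulrC.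
rewrite -[RHS]/(l eta) [in RHS]etaE !linear_sum; apply: eq_bigr => i _.
by rewrite !linearZ; exact: mulrC.
Qed.

Lemma form_NP A (pi : multivector A) (w : ext_form A) x (X : A x) :
  form_flat (form_N pi w) X = form_flat w (recursion_op pi w X).
Proof.
apply/lfunP => Y; rewrite /form_flat -/(form_flat w _).
have -> : (fun Y => form_N pi w [:: X; Y] : R^o) = form_flat w (recursion_op pi w X).
  by apply/funext.
exact: lfunE.
Qed.

End Algebroids.

Arguments anchor {R n M r A} L x v f : rename.

(** * The Lie algebroid on the pullback of A to M x R *)

Section Tilde.
Context {R : realType} {n : nat} {M : manifold R n} {r : nat}.
Implicit Types A : vector_bundle M r.

Definition time_slice A (X : section (bundle_times_line A)) (t : R) :
  section A := fun x => X (x, t).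

(* Sections of the pullback are time-dependent sections of [A]; the derivative
   in the fibre is taken coordinatewise in a basis, which is independent of the
   basis. *)
Definition time_derivative A (X : section (bundle_times_line A)) :
    section (bundle_times_line A) := fun p =>
  \sum_i derive1 (fun t => coord (vbasis fullv) i (time_slice X t p.1)) p.2
         *: (vbasis fullv)`_i.

Definition tilde_algebroid A (L : algebroid A)
    (phi : section (dual_bundle A)) : algebroid (bundle_times_line A) :=
  {| bracket X Y := fun p =>
       bracket L (time_slice X p.2) (time_slice Y p.2) p.1
       + phi p.1 (X p) *: time_derivative Y p
       - phi p.1 (Y p) *: time_derivative X p;
     anchor p v f := anchor L p.1 v (fun y => f (y, p.2))
                     + phi p.1 v * derive1 (fun t => f (p.1, t)) p.2 |}.

Definition tilde_multivector A (pi : multivector A) :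
    multivector (bundle_times_line A) := fun p s => expR (- p.2) * pi p.1 s.

Definition tilde_form A (w : ext_form A) : ext_form (bundle_times_line A) :=
  fun p s => expR p.2 * w p.1 s.

End Tilde.

(* Main.v *)
(* For smooth sections X_0, X_1, X_2 of the pullback, the terms containing time
   derivatives cancel in d(e^t w)(X_0, X_1, X_2), which at time t equals e^t
   times (d_{A,phi} w) evaluated on the slices of the X_i at t; as
   omega_N = - pi(omega^flat _, omega^flat _) is a 2-form and the 2-form
   attached to the pair (e^-t pi, e^t omega) is e^t omega_N, this settles both
   closedness conditions.

   For the bivector, the Leibniz rule reduces [e^-t pi, e^-t pi] to [pi, pi] and
   [pi, e^-t] on M x R, and one finds [pi, e^-t] = e^-t iota_phi pi, whence
   [e^-t pi, e^-t pi] = e^-2t [pi, pi]_{A,phi}.  The Schouten brackets are only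
   known on global sections, so that both computations need pi to be, near a
   given point, a sum of products of global functions and sections.  This is
   achieved with bump functions: if g(x) = 1 then chi = 1 - (1 - g)^2 satisfies
   [D, chi](x) = 0 because [D, _] is a derivation, and hence
   [D, chi E](x) = [D, E](x). *)

Require Import Defs.
From mathcomp Require Import all_boot all_order all_algebra.
From mathcomp Require Import all_classical all_reals all_analysis.
From mathcomp Require Import ring.

Set Implicit Arguments.
Unset Strict Implicit.
Unset Printing Implicit Defensive.

Import Order.TTheory GRing.Theory Num.Theory.
Import numFieldNormedType.Exports.
Local Open Scope classical_set_scope.
Local Open Scope ring_scope.

(** * Functions of class C^k on open subsets of a normed space *)

Section CkCalculus.
Context {R : realType} {V : normedModType R}.
Implicit Types (k : nat) (U W : set V) (f g : V -> R) (b : R -> R).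

Lemma Ck_onW k U f : Ck_on k.+1 U f -> Ck_on k U f.
Proof.
elim: k f => [|k IH] f [fc fd]; first by split.
split=> // v; have [dv cv] := fd v; split=> //; exact: IH.
Qed.

Lemma Ck_on_ext k U f g : open U -> {in U, f =1 g} ->
  Ck_on k U f -> Ck_on k U g.
Proof.
move=> oU; have nearU (f' g' : V -> R) : {in U, f' =1 g'} ->
    forall u, U u -> {near u, f' =1 g'}.
  move=> fg u Uu; have : nbhs u U by exact: open_nbhs_nbhs.
  by apply: filterS => w Uw; apply: fg; rewrite inE.
have contU f' g' u : {in U, f' =1 g'} -> U u ->
    {for u, continuous f'} -> {for u, continuous g'}.
  move=> fg Uu; rewrite /prop_for /continuous_at -(fg u) ?inE//.
  by apply: cvg_trans; apply: near_eq_cvg; exact: nearU.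
elim: k f g => [|k IH] f g fg [fc fd].
  by split=> // u Uu; exact: contU (fc u Uu).
split=> [u Uu|v]; first exact: contU (fc u Uu).
have [dv cv] := fd v; split=> [u Uu|].
  exact: near_eq_derivable (nearU _ _ fg u Uu) (dv u Uu).
apply: IH cv => u; rewrite inE => Uu.
exact: near_eq_derive (nearU _ _ fg u Uu).
Qed.

Lemma Ck_on_bigcup k I (D : set I) (F : I -> set V) f :
  (forall i, D i -> Ck_on k (F i) f) -> Ck_on k (\bigcup_(i in D) F i) f.
Proof.
elim: k f => [|k IH] f fF; split=> //.
- by move=> u [i Di Fiu]; have [fc _] := fF i Di; exact: fc.
- by move=> u [i Di Fiu]; have [fc _] := fF i Di; exact: fc.
move=> v; split=> [u [i Di Fiu]|].
  by have [_ /(_ v)[dv _]] := fF i Di; exact: dv.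
by apply: IH => i Di; have [_ /(_ v)[]] := fF i Di.
Qed.

Lemma Ck_on_setU k U W f : Ck_on k U f -> Ck_on k W f -> Ck_on k (U `|` W) f.
Proof.
by move=> fU fW; rewrite -bigcup2E; apply: Ck_on_bigcup => -[|[|i]] // _;
  apply: (Ck_on_sub (U := U)).
Qed.

Lemma Ck_onD k U f g : open U -> Ck_on k U f -> Ck_on k U g ->
  Ck_on k U (f \+ g).
Proof.
move=> oU; elim: k f g => [|k IH] f g [fc fd] [gc gd]; split=> //.
- by move=> u Uu; apply: cvgD; [exact: fc | exact: gc].
- by move=> u Uu; apply: cvgD; [exact: fc | exact: gc].
move=> v; have [dfv cfv] := fd v; have [dgv cgv] := gd v; split=> [u Uu|].
  by apply: derivableD; [exact: dfv | exact: dgv].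
apply: (@Ck_on_ext _ _ ('D_v f \+ 'D_v g)) => //; last exact: IH.
by move=> u; rewrite inE => Uu; rewrite deriveD//; [exact: dfv|exact: dgv].
Qed.

Lemma Ck_onM k U f g : open U -> Ck_on k U f -> Ck_on k U g ->
  Ck_on k U (f \* g).
Proof.
move=> oU; elim: k f g => [|k IH] f g Cf Cg.
  by split=> // u Uu; apply: cvgM; [exact: Cf.1 | exact: Cg.1].
have [Cf' Cg'] := (Ck_onW Cf, Ck_onW Cg).
case: Cf Cg => [fc fd] [gc gd]; split=> [u Uu|v].
  by apply: cvgM; [exact: fc | exact: gc].
have [dfv cfv] := fd v; have [dgv cgv] := gd v; split=> [u Uu|].
  by apply: derivableM; [exact: dfv | exact: dgv].
apply: (@Ck_on_ext _ _ ((f \* 'D_v g) \+ (g \* 'D_v f))) => //.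
  by move=> u; rewrite inE => Uu; rewrite deriveM//; [exact: dfv|exact: dgv].
by apply: Ck_onD => //; exact: IH.
Qed.

Lemma derive_line f (x v : V) : 'D_v f x =
  derive1 (fun h : R => f (h *: v + x)) 0.
Proof.
rewrite derive1E /derive.
set g1 := fun h => h^-1 *: _; set g2 := fun h => h^-1 *: _.
suff -> : g1 = g2 by [].
by apply/funext => h; rewrite /g1 /g2 /= addr0 scale0r add0r [_%:A]mulr1.
Qed.

Lemma is_derive_compR b f (x v : V) : derivable b (f x) 1 -> derivable f x v ->
  is_derive x v (b \o f) (derive1 b (f x) * 'D_v f x).
Proof.
move=> db /derivable1P df; set F := fun h : R => f (h *: v + x).
have F0 : F 0 = f x by rewrite /F scale0r add0r.
have dF0 : derivable b (F 0) 1 by rewrite F0.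
have dbF : derivable (b \o F) 0 1.
  apply/derivable1_diffP.
  exact/differentiable_comp/derivable1_diffP/dF0/derivable1_diffP.
apply: DeriveDef; first exact/derivable1P.
rewrite (derive_line f) (derive_line (b \o f)) -F0.
exact: (derive1_comp df dF0).
Qed.

Lemma Ck_on_comp k U b f : open U -> Ck_on k setT b -> Ck_on k U f ->
  Ck_on k U (b \o f).
Proof.
move=> oU; elim: k b f => [|k IH] b f Cb Cf.
  by split=> // u Uu; apply: continuous_comp; [exact: Cf.1 | exact: Cb.1].
have Cf' := Ck_onW Cf.
case: Cb Cf => [bc bd] [fc fd]; split=> [u Uu|v].
  by apply: continuous_comp; [exact: fc | exact: bc].
have [dfv cfv] := fd v; have [db cb] := bd 1.
have dc u (Uu : U u) : is_derive u v (b \o f) (derive1 b (f u) * 'D_v f u).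
  by apply: is_derive_compR; [exact: db | exact: dfv].
split=> [u Uu|]; first by have [] := dc u Uu.
apply: (@Ck_on_ext _ _ (('D_1 b \o f) \* 'D_v f)) => //.
  by move=> u; rewrite inE => /dc[_ ->]; rewrite derive1E.
by apply: Ck_onM => //; exact: IH.
Qed.

Lemma Ck_on_sum k U (I : Type) (s : seq I) (F : I -> V -> R) : open U ->
  (forall i, Ck_on k U (F i)) -> Ck_on k U (fun u => \sum_(i <- s) F i u).
Proof.
move=> oU CF; elim: s => [|i s IH].
  by under eq_fun do rewrite big_nil; exact: Ck_on_cst.
by under eq_fun do rewrite big_cons; exact: Ck_onD.
Qed.

Lemma Ck_on_prod k U (I : Type) (s : seq I) (F : I -> V -> R) : open U ->
  (forall i, Ck_on k U (F i)) -> Ck_on k U (fun u => \prod_(i <- s) F i u).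
Proof.
move=> oU CF; elim: s => [|i s IH].
  by under eq_fun do rewrite big_nil; exact: Ck_on_cst.
by under eq_fun do rewrite big_cons; exact: Ck_onM.
Qed.

Lemma Ck_on_affine (V' : normedModType R) k U f (l : V' -> V) (c : V) :
  linear l -> continuous l -> Ck_on k U f ->
  Ck_on k [set u | U (l u + c)] (fun u => f (l u + c)).
Proof.
move=> ll lc; elim: k f => [|k IH] f [fc fd].
  split=> // u Uu; apply: (@continuous_comp _ _ _ (fun u => l u + c) f).
    by apply: cvgD; [exact: lc | exact: cvg_cst].
  exact: fc.
have quotE u v :
    (fun h : R => h^-1 *: (((fun u => f (l u + c)) \o shift u) (h *: v)
                           - f (l u + c)))
    = (fun h : R => h^-1 *: ((f \o shift (l u + c)) (h *: l v) - f (l u + c))).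
  by apply/funext => h /=; rewrite ll addrA.
split=> [u Uu|v].
  apply: (@continuous_comp _ _ _ (fun u => l u + c) f).
    by apply: cvgD; [exact: lc | exact: cvg_cst].
  exact: fc.
have [dv cv] := fd (l v); split.
  by move=> u /dv; rewrite /derivable quotE.
have -> : 'D_v (fun u => f (l u + c)) = (fun u => 'D_(l v) f (l u + c)).
  by apply/funext => u; rewrite /derive quotE.
exact: (IH _ cv).
Qed.

End CkCalculus.

Section FlatFunctions.
Context {R : realType}.
Implicit Types (k : nat) (x : R).

Lemma Ck_on_is_derive1 (f df : R -> R) k : (forall x, is_derive x 1 f (df x)) ->
  Ck_on k setT df -> Ck_on k.+1 setT f.
Proof.
move=> fP Cdf; have dv (x v : R) : is_derive x v f (v * df x).
  have [_ Dx] := fP x; have dx : derivable f x 1 by [].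
  move/derivable1_diffP : dx => dx; apply: DeriveDef.
    exact: diff_derivable.
  by rewrite deriveE// -[in LHS](mulr1 v) linearZ/= -deriveE// Dx.
split=> [x _|v].
  by apply/differentiable_continuous/derivable1_diffP; have [] := fP x.
split=> [x _|]; first by have [] := dv x v.
have -> : 'D_v f = cst v \* df by apply/funext => x; have [_ ->] := dv x v.
by apply: Ck_onM => //; [exact: openT | exact: Ck_on_cst].
Qed.

Lemma Ck_on_expR k : Ck_on k setT (@expR R).
Proof.
elim: k => [|k IH]; first by split=> // x _; exact: continuous_expR.
by apply: (Ck_on_is_derive1 _ IH) => x; exact: is_derive_expR.
Qed.

Definition flat_exp k x : R := if 0 < x then x^-1 ^+ k * expR (- x^-1) else 0.

Lemma flat_exp_le k x : `|flat_exp k x| <= k.+2`!%:R * x ^+ 2.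
Proof.
rewrite /flat_exp; case: ifPn => [x0|_]; last first.
  by rewrite normr0 mulr_ge0// sqr_ge0.
have xV0 : 0 < x^-1 by rewrite invr_gt0.
rewrite ger0_norm; last by rewrite mulr_ge0 ?expR_ge0// exprn_ge0// ltW.
have le_expR : x^-1 ^+ k.+2 / k.+2`!%:R <= expR x^-1.
  by apply: le_trans (expR_ge1Dxn k.+1 (ltW xV0)); rewrite lerDr ler01.
rewrite expRN ler_pdivrMr ?expR_gt0//.
apply: le_trans (ler_wpM2l _ le_expR); last by rewrite mulr_ge0// sqr_ge0.
have fact_neq0 : k.+2`!%:R != 0 :> R by rewrite pnatr_eq0 -lt0n fact_gt0.
rewrite [leRHS](_ : _ = x^-1 ^+ k.+2 * x ^+ 2); last by field.
by rewrite -addn2 exprD -mulrA -exprMn mulVf ?gt_eqF// expr1n mulr1.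
Qed.

Lemma is_derive_flat_exp k x :
  is_derive x 1 (flat_exp k) (flat_exp k.+2 x - k%:R * flat_exp k.+1 x).
Proof.
have [x0|x0|->] := ltgtP x 0.
- have -> : flat_exp k.+2 x - k%:R * flat_exp k.+1 x = 0.
    by rewrite /flat_exp ltNge (ltW x0)/= mulr0 subr0.
  have d0 := @is_derive_cst R R R 0 x 1.
  apply: near_eq_is_derive d0.
  near=> y; rewrite /flat_exp ifF//; apply/negbTE; rewrite -leNgt ltW//.
  by near: y; exact: lt_nbhsl.
- have dV : is_derive x 1 (fun y : R => y^-1) (- x^-1 ^+ 2).
    rewrite exprVn -[- _]mulr1; apply: is_deriveV; first by rewrite gt_eqF.
  have dE : is_derive x 1 (fun y : R => expR (- y^-1))
                (- (- x^-1 ^+ 2) * expR (- x^-1)).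
    have dN : is_derive x 1 (fun y : R => - y^-1) (- - x^-1 ^+ 2).
      exact: is_deriveN dV.
    have := @is_derive1_comp R expR (fun y => - y^-1) x _ _
      (is_derive_expR _) dN.
    by rewrite mulrC.
  have dg : is_derive x 1 (fun y : R => y^-1 ^+ k * expR (- y^-1))
                (flat_exp k.+2 x - k%:R * flat_exp k.+1 x).
    have := is_deriveM (is_deriveX k dV) dE; rewrite exprfctE.
    move/is_derive_eq; apply; rewrite /flat_exp x0.
    have scaleE (a b : R) : a *: b = a * b by [].
    rewrite !scaleE.
    by case: k => [|k]; rewrite ?exprS /=; ring.
  apply: near_eq_is_derive dg.
  by near=> y; rewrite /flat_exp ifT//; near: y; exact: lt_nbhsr.
- have -> : flat_exp k.+2 0 - k%:R * flat_exp k.+1 0 = 0.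
    by rewrite /flat_exp ltxx mulr0 subr0.
  have cv0 : (h^-1 *: (flat_exp k (h *: 1 + 0) - flat_exp k 0))
      @[h --> 0^'] --> 0.
    apply/cvgr0Pnorm_lt => e e0; near=> h.
    have h0 : h != 0 by near: h; exact: nbhs_dnbhs_neq.
    rewrite /flat_exp ltxx -/(flat_exp k _) subr0 addr0.
    rewrite [h *: 1]mulr1 normrZ normfV mulrC ltr_pdivrMr ?normr_gt0//.
    apply: le_lt_trans (flat_exp_le k h) _.
    rewrite -real_normK ?num_real// expr2 mulrA ltr_pM2r ?normr_gt0//.
    rewrite -ltr_pdivlMl ?ltr0n ?fact_gt0//.
    near: h; apply: dnbhs0_lt; rewrite mulr_gt0// invr_gt0 ltr0n fact_gt0//.
  by apply: DeriveDef; [apply/cvg_ex; exists 0 | exact: cvg_lim].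
Unshelve. all: by end_near. Qed.

Lemma Ck_on_flat_exp k j : Ck_on k setT (flat_exp j).
Proof.
elim: k j => [|k IH] j.
  split=> // x _; apply/differentiable_continuous/derivable1_diffP.
  by have [] := is_derive_flat_exp j x.
apply: (Ck_on_is_derive1 (is_derive_flat_exp j)).
rewrite (_ : (fun _ => _) = flat_exp j.+2 \+ (cst (- j%:R) \* flat_exp j.+1)).
  apply: Ck_onD; [exact: openT | exact: IH |].
  by apply: Ck_onM; [exact: openT | exact: Ck_on_cst | exact: IH].
by apply/funext => x /=; rewrite mulNr.
Qed.

Definition cutoff (e s : R) : R :=
  flat_exp 0 (1 - (e^-1 * s) ^+ 2) / flat_exp 0 1.

Lemma cutoff0 e : cutoff e 0 = 1.
Proof.
rewrite /cutoff mulr0 expr0n subr0 divff// /flat_exp ltr01 expr0 mul1r.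
by rewrite gt_eqF// expR_gt0.
Qed.

Lemma cutoff_eq0 e s : 0 < e -> e <= `|s| -> cutoff e s = 0.
Proof.
move=> e0 es; rewrite /cutoff /flat_exp ifF ?mul0r//; apply/negbTE.
rewrite -leNgt subr_le0 -real_normK ?num_real// exprn_ege1//.
rewrite normrM normfV. rewrite (gtr0_norm e0).
by rewrite mulrC ler_pdivlMr// mul1r.
Qed.

Lemma Ck_on_cutoff k e : Ck_on k setT (cutoff e).
Proof.
have Cid := @Ck_on_id R k setT; have oT := @openT R.
have Cc (a : R) := @Ck_on_cst R R k setT a.
have Cl := Ck_onM oT (Cc e^-1) Cid.
have Cq := Ck_onD oT (Cc 1) (Ck_onM oT (Cc (-1)) (Ck_onM oT Cl Cl)).
rewrite (_ : cutoff e = (flat_exp 0 \o (cst 1 \+ (cst (-1) \*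
  ((cst e^-1 \* id) \* (cst e^-1 \* id))))) \* cst (flat_exp 0 1)^-1).
  by apply: Ck_onM => //; apply: Ck_on_comp => //; exact: Ck_on_flat_exp.
by apply/funext => s; rewrite /cutoff /= mulN1r expr2.
Qed.

End FlatFunctions.

(** * Smooth functions on a manifold *)

Section SmoothFun.
Context {R : realType} {n : nat} {M : manifold R n}.
Implicit Types (U W K : set M) (f g : M -> R) (c d : chart R M n).

Lemma chart_image_open c U : atlas M c -> open U ->
  open (c @` (chart_dom c `&` U)).
Proof.
move=> /atlas_chart[od oi cK _ ic] oU; rewrite openE => _ [x [dx Ux] <-].
have img : (c @` chart_dom c) (c x) by exists x.
have nU : nbhs (c x) (chart_inv c @^-1` U).
  by apply: (ic _ img); rewrite cK//; exact: open_nbhs_nbhs.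
have nI : nbhs (c x) (c @` chart_dom c) by exact: open_nbhs_nbhs.
apply: filterS (filterI nI nU) => _ [[y dy <-] /=].
by rewrite cK// => Uy; exists y.
Qed.

Lemma smooth_fun_sub U W f : W `<=` U -> smooth_fun U f -> smooth_fun W f.
Proof.
move=> WU sf c Ac k; apply: Ck_on_sub (sf c Ac k).
by move=> _ [x [dx Wx] <-]; exists x => //; split=> //; exact: WU.
Qed.

Lemma smooth_fun_ext U f g : open U -> {in U, f =1 g} ->
  smooth_fun U f -> smooth_fun U g.
Proof.
move=> oU fg sf c Ac k; apply: Ck_on_ext (sf c Ac k).
  exact: chart_image_open.
have [_ _ cK _ _] := atlas_chart Ac.
move=> u; rewrite inE => -[x [dx Ux] <-]; rewrite cK//.
by apply: fg; rewrite inE.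
Qed.

Lemma smooth_fun_bigcup I (D : set I) (F : I -> set M) f :
  (forall i, D i -> smooth_fun (F i) f) ->
  smooth_fun (\bigcup_(i in D) F i) f.
Proof.
move=> sf c Ac k; rewrite setI_bigcupr image_bigcup.
by apply: Ck_on_bigcup => i Di; exact: sf.
Qed.

Lemma smooth_fun_setU U W f :
  smooth_fun U f -> smooth_fun W f -> smooth_fun (U `|` W) f.
Proof.
by move=> sU sW c Ac k; rewrite setIUr image_setU; apply: Ck_on_setU;
  [exact: sU | exact: sW].
Qed.

Lemma smooth_fun_cst U (a : R) : smooth_fun U (fun=> a).
Proof. by move=> c _ k; exact: Ck_on_cst. Qed.

Lemma smooth_funD U f g : open U -> smooth_fun U f -> smooth_fun U g ->
  smooth_fun U (fun x => f x + g x).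
Proof.
move=> oU sf sg c Ac k.
by apply: Ck_onD; [exact: chart_image_open | exact: sf | exact: sg].
Qed.

Lemma smooth_funM U f g : open U -> smooth_fun U f -> smooth_fun U g ->
  smooth_fun U (fun x => f x * g x).
Proof.
move=> oU sf sg c Ac k.
by apply: Ck_onM; [exact: chart_image_open | exact: sf | exact: sg].
Qed.

Lemma smooth_fun_sum U (I : Type) (s : seq I) (F : I -> M -> R) : open U ->
  (forall i, smooth_fun U (F i)) -> smooth_fun U (fun x => \sum_(i <- s) F i x).
Proof.
move=> oU sF c Ac k.
by apply: Ck_on_sum; [exact: chart_image_open | move=> i; exact: sF].
Qed.

Lemma smooth_fun_supp U W K f : open U -> open W -> closed K ->
  K `<=` U -> smooth_fun (U `&` W) f -> (forall x, ~ K x -> f x = 0) ->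
  smooth_fun W f.
Proof.
move=> oU oW cK KU sf f0.
have -> : W = (U `&` W) `|` (~` K `&` W).
  rewrite -setIUl; apply/seteqP; split=> [x Wx|x []//]; split=> //.
  by have [/KU|] := pselect (K x); [left | right].
apply: smooth_fun_setU => //.
apply: (@smooth_fun_ext _ (fun=> 0)); last exact: smooth_fun_cst.
  by apply: openI => //; exact: closed_openC.
by move=> x; rewrite inE => -[/f0].
Qed.

Lemma smooth_bump (x0 : M) U : open U -> U x0 -> exists (h : M -> R) K,
  [/\ closed K, K `<=` U, smooth_fun setT h, h x0 = 1 &
      forall x, ~ K x -> h x = 0].
Proof.
move=> oU Ux0; have [c Ac dx0] := atlas_cover x0.
have [od oi cK cc ic] := atlas_chart Ac.
have oI := chart_image_open Ac oU.
have : nbhs (c x0) (c @` (chart_dom c `&` U)).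
  by apply: open_nbhs_nbhs; split=> //; exists x0.
move=> /nbhs_ballP[e /= e0 eU]; pose a := c x0; pose e2 := e / 2.
have e20 : 0 < e2 by rewrite divr_gt0.
pose B := [set u : 'rV[R]_n |
  forall i, `[a 0 i - e2, a 0 i + e2]%classic (u 0 i)].
have cB : compact B.
  apply: (@rV_compact R n (fun i => `[a 0 i - e2, a 0 i + e2]%classic)).
  by move=> i; exact: segment_compact.
have BU : B `<=` c @` (chart_dom c `&` U).
  move=> u Bu; apply: eU; split=> // i j; rewrite ord1 /ball/=.
  have := Bu j; rewrite /= in_itv/= -ler_distl distrC => /le_lt_trans; apply.
  by rewrite /e2 ltr_pdivrMr// ltr_pMr// ltr1n.
pose K := chart_inv c @` B.
have KU : K `<=` chart_dom c `&` U.
  by move=> _ [u /BU[x [dx Ux] <-] <-]; rewrite cK.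
have clK : closed K.
  apply: compact_closed; first exact: manifold_hausdorff.
  apply: continuous_compact => //; apply: continuous_in_subspaceT => u.
  by rewrite inE => /BU[x [dx _] <-]; apply: ic; exists x.
pose b (u : 'rV[R]_n) : R := \prod_i cutoff e2 (u 0 i - a 0 i).
pose h (x : M) := if x \in chart_dom c then b (c x) else 0.
have h0 x : ~ K x -> h x = 0.
  rewrite /h; case: ifPn => //; rewrite inE => dx nK.
  have nB : ~ B (c x) by move=> Bx; apply: nK; exists (c x) => //; exact: cK.
  have [i] : exists i, ~ `[a 0 i - e2, a 0 i + e2]%classic (c x 0 i).
    exact/existsNP.
  rewrite /= in_itv/= -ler_distl => /negP; rewrite -ltNge => /ltW ei.
  by rewrite /b (bigD1 i)//= cutoff_eq0 ?mul0r.
exists h, K; split=> //; first by move=> x /KU[].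
  apply: (@smooth_fun_supp (chart_dom c)) clK _ _ h0 => //; first exact: openT.
    by move=> x /KU[].
  rewrite setIT => d Ad k; have [_ _ dK _ _] := atlas_chart Ad.
  apply: (@Ck_on_ext _ _ _ _ (fun u => b (c (chart_inv d u)))).
  - exact: chart_image_open.
  - move=> u; rewrite inE => -[x [dx cx] <-].
    by rewrite /h dK// ifT// inE.
  apply: Ck_on_prod; first exact: chart_image_open.
  move=> i; apply: (@Ck_on_comp _ _ _ _ (cutoff e2)).
  - exact: chart_image_open.
  - exact: Ck_on_cutoff.
  apply: Ck_onD; first exact: chart_image_open.
    exact: (atlas_transition Ad Ac).
  exact: Ck_on_cst.
rewrite /h ifT ?inE// /b big1// => i _; rewrite subrr; exact: cutoff0.
Qed.

End SmoothFun.


(** * Exterior forms *)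

Section WedgeOnLists.
Context {R : realType} {T : Type}.
Implicit Types (a b : seq T -> R) (s : seq T).

Definition wedge_seq a b s : R :=
  \sum_(m : (size s).-tuple bool)
    (-1) ^+ shuffle_inv m * a (mask m s) * b (mask (map negb m) s).

Definition parity_twist a s : R := (-1) ^+ size s * a s.

Lemma big_bool_tupleS k (F : bitseq -> R) :
  \sum_(m : k.+1.-tuple bool) F m
  = \sum_(m : k.-tuple bool) F (true :: m)
    + \sum_(m : k.-tuple bool) F (false :: m).
Proof.
pose h (p : bool * k.-tuple bool) := [tuple of p.1 :: p.2].
rewrite (reindex h); last first.
  exists (fun m => (thead m, [tuple of behead m])) => [[c m] _|m _] /=.
    by rewrite theadE; congr pair; exact: val_inj.
  by apply: val_inj; rewrite /= [in RHS](tuple_eta m).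
rewrite -(pair_bigA _ (fun c (m : k.-tuple bool) => F (c :: m))) /=.
by rewrite big_bool.
Qed.

Lemma wedge_seq_nil a b : wedge_seq a b [::] = a [::] * b [::].
Proof.
rewrite /wedge_seq (big_pred1 [tuple])/= ?mul1r// => m.
by rewrite [m]tuple0; apply/esym/eqP/val_inj.
Qed.

Lemma wedge_seq_cons a b v s :
  wedge_seq a b (v :: s) = wedge_seq (a \o cons v) b s
                           + wedge_seq (parity_twist a) (b \o cons v) s.
Proof.
rewrite /wedge_seq /= (big_bool_tupleS _ (fun m => (-1) ^+ shuffle_inv m
  * a (mask m (v :: s)) * b (mask (map negb m) (v :: s)))) /=.
congr (_ + _); apply: eq_bigr => m _.
by rewrite /parity_twist size_mask ?size_tuple// exprD mulrA [_ ^+ _ * _]mulrC.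
Qed.

Lemma wedge_seq_suppl a b s : (forall v s, a (v :: s) = 0) ->
  wedge_seq a b s = a [::] * b s.
Proof.
elim: s a b => [|v s IH] a b a0; first exact: wedge_seq_nil.
rewrite wedge_seq_cons IH ?IH /=.
- by rewrite a0 /parity_twist mul0r add0r mul1r.
- by move=> w t; rewrite /parity_twist a0 mulr0.
- by move=> w t /=; rewrite a0.
Qed.

Lemma wedge_seq_suppr a b s : (forall v s, b (v :: s) = 0) ->
  wedge_seq a b s = a s * b [::].
Proof.
elim: s a b => [|v s IH] a b b0; first exact: wedge_seq_nil.
by rewrite wedge_seq_cons IH// IH//= b0 mulr0 addr0.
Qed.

End WedgeOnLists.

Section Alternating.
Context {R : realType} {V : lmodType R}.
Variables (w : seq V -> R) (wP : alternating_form w).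

Lemma alt_form2Dl a u v z :
  w [:: a *: u + v; z] = a * w [:: u; z] + w [:: v; z].
Proof. exact: (wP.1 [::] [:: z]). Qed.

Lemma alt_form2Dr a u v z :
  w [:: z; a *: u + v] = a * w [:: z; u] + w [:: z; v].
Proof. exact: (wP.1 [:: z] [::]). Qed.

Lemma alt_form2_diag u : w [:: u; u] = 0.
Proof. by apply: wP.2; rewrite /= inE eqxx. Qed.

Lemma alt_form2_0l z : w [:: 0; z] = 0.
Proof.
by have := alt_form2Dl (-1) 0 0 z; rewrite scaler0 addr0 mulN1r addNr.
Qed.

Lemma alt_form2_0r z : w [:: z; 0] = 0.
Proof.
by have := alt_form2Dr (-1) 0 0 z; rewrite scaler0 addr0 mulN1r addNr.
Qed.

Lemma alt_form2Zl a u z : w [:: a *: u; z] = a * w [:: u; z].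
Proof. by rewrite -[a *: u]addr0 alt_form2Dl alt_form2_0l addr0. Qed.

Lemma alt_form2Zr a u z : w [:: z; a *: u] = a * w [:: z; u].
Proof. by rewrite -[a *: u]addr0 alt_form2Dr alt_form2_0r addr0. Qed.

Lemma alt_form2C u v : w [:: u; v] = - w [:: v; u].
Proof.
apply/eqP; rewrite -addr_eq0; apply/eqP.
have := alt_form2_diag (1 *: u + v).
by rewrite alt_form2Dl !alt_form2Dr !alt_form2_diag !mul1r add0r addr0.
Qed.

Lemma alt_form2_suml I (s : seq I) (a : I -> R) (u : I -> V) z :
  w [:: \sum_(i <- s) a i *: u i; z] = \sum_(i <- s) a i * w [:: u i; z].
Proof.
elim: s => [|i s IH]; first by rewrite !big_nil alt_form2_0l.
by rewrite !big_cons alt_form2Dl IH.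
Qed.

Lemma alt_form2_sumr I (s : seq I) (a : I -> R) (u : I -> V) z :
  w [:: z; \sum_(i <- s) a i *: u i] = \sum_(i <- s) a i * w [:: z; u i].
Proof.
elim: s => [|i s IH]; first by rewrite !big_nil alt_form2_0r.
by rewrite !big_cons alt_form2Dr IH.
Qed.

End Alternating.

Section FormCalculus.
Context {R : realType} {n : nat} {M : manifold R n} {r : nat}.
Implicit Types (E : vector_bundle M r) (f : M -> R) (x : M).

Lemma frame_open E (e : local_frame E r) : frames E e -> open (frame_dom e).
Proof. by move=> /frames_frame[]. Qed.

Lemma frame_sum E (e : local_frame E r) x (v : E x) : frames E e ->
  frame_dom e x -> v = \sum_i coframe e i x v *: frame e i x.
Proof. by move=> /frames_frame[_ eP] /eP[_]. Qed.

Lemma coframe_sum E (e : local_frame E r) x (xi : 'Hom(E x, R^o)) :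
  frames E e -> frame_dom e x ->
  xi = \sum_i (xi (frame e i x) : R) *: coframe e i x.
Proof.
move=> Ee ex; have Ede : frames (dual_bundle E) (dual_frame e) by exists e.
rewrite {1}(@frame_sum (dual_bundle E) _ _ xi Ede ex).
by apply: eq_bigr => i _; rewrite dual_coframeE.
Qed.

Lemma smooth_fun_frames E f :
  (forall e, frames E e -> smooth_fun (frame_dom e) f) -> smooth_fun setT f.
Proof.
move=> sf; rewrite (_ : setT = \bigcup_(e in frames E) frame_dom e).
  exact: smooth_fun_bigcup.
apply/seteqP; split=> // x _.
by have [e Ee ex] := frames_cover E x; exists e.
Qed.

Lemma ext_formP E (w1 w2 : ext_form E) :
  (forall x s, w1 x s = w2 x s) -> w1 = w2.
Proof.
move=> w12; apply: functional_extensionality_dep => x.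
by apply/funext => s; exact: w12.
Qed.

Definition form2 E (B : forall x, E x -> E x -> R) : ext_form E :=
  fun x s => if s is [:: u; v] then B x u v else 0.

Lemma kform_form2 E (B : forall x, E x -> E x -> R) :
  (forall x a u v z, B x (a *: u + v) z = a * B x u z + B x v z) ->
  (forall x a u v z, B x z (a *: u + v) = a * B x z u + B x z v) ->
  (forall x u, B x u u = 0) ->
  (forall e, frames E e -> forall i j,
     smooth_fun (frame_dom e) (fun x => B x (frame e i x) (frame e j x))) ->
  kform 2 (form2 B).
Proof.
move=> Bl Br B0 sB; split; last by move=> x [|? [|? [|]]].
split=> [x|e Ee [|i [|j [|? ?]]]]; try exact: smooth_fun_cst; last exact: sB.
split=> [[|z [|z' s1]] s2 a u v|].
- by case: s2 => [|z [|? ?]] //=; rewrite ?mulr0 ?addr0.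
- by case: s2 => [|? ?] /=; rewrite ?mulr0 ?addr0.
- by case: s1 => [|? ?] /=; rewrite ?mulr0 ?addr0.
- by case=> [|u [|v [|? ?]]] //=; rewrite inE andbT negbK => /eqP->; exact: B0.
Qed.

Lemma kform0 E f : smooth_fun setT f -> kform 0 (form0 f : ext_form E).
Proof.
move=> sf; split; last by move=> x [].
split=> [x|e Ee [|? ?]]; last 2 first.
- exact: smooth_fun_sub sf.
- exact: smooth_fun_cst.
split=> [[|z s1] s2 a u v|[]//]; by rewrite /= mulr0 addr0.
Qed.

Lemma kform_vector1 E (X : section E) : smooth_section X -> kform 1 (vector1 X).
Proof.
move=> sX; split; last by move=> x [|? []].
split=> [x|_ [e Ee <-] [|i [|? ?]]]; try exact: smooth_fun_cst; last exact: sX.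
split=> [[|z s1] s2 a u v|[|? []]//].
  case: s2 => [|? ?] /=; last by rewrite mulr0 addr0.
  by rewrite add_lfunE scale_lfunE.
by case: s1 => [|? ?] /=; rewrite mulr0 addr0.
Qed.

Lemma kformZ E k f (w : ext_form E) : smooth_fun setT f -> kform k w ->
  kform k (fun x s => f x * w x s).
Proof.
move=> sf [[wa ws] wk]; split; last by move=> x s /wk->; rewrite mulr0.
split=> [x|e Ee I].
  have [wl w0] := wa x; split=> [s1 s2 a u v|s us].
    by rewrite wl mulrDr mulrCA.
  by rewrite w0// mulr0.
apply: smooth_funM; [exact: frame_open | exact: smooth_fun_sub sf | exact: ws].
Qed.

Lemma kformD E k (w1 w2 : ext_form E) : kform k w1 -> kform k w2 ->
  kform k (fun x s => w1 x s + w2 x s).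
Proof.
move=> [[w1a w1s] w1k] [[w2a w2s] w2k].
split; last by move=> x s sk; rewrite w1k// w2k// addr0.
split=> [x|e Ee I].
  have [wl1 w01] := w1a x; have [wl2 w02] := w2a x.
  split=> [s1 s2 a u v|s us]; first by rewrite wl1 wl2; ring.
  by rewrite w01// w02// addr0.
by apply: smooth_funD; [exact: frame_open | exact: w1s | exact: w2s].
Qed.

Lemma kform_cst0 E k : kform k ((fun _ _ => 0) : ext_form E).
Proof.
split=> //; split=> [x|e Ee I]; last exact: smooth_fun_cst.
by split=> [s1 s2 a u v|//]; rewrite mulr0 addr0.
Qed.

Lemma kform_sum E k I (s : seq I) (w : I -> ext_form E) :
  (forall i, kform k (w i)) -> kform k (fun x l => \sum_(i <- s) w i x l).
Proof.
move=> kw; elim: s => [|i s IH].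
  rewrite (_ : (fun _ _ => _) = fun x s => 0); first exact: kform_cst0.
  by apply: ext_formP => x l; rewrite big_nil.
rewrite (_ : (fun _ _ => _) = fun x l => w i x l + \sum_(i <- s) w i x l).
  exact: kformD.
by apply: ext_formP => x l; rewrite big_cons.
Qed.

Lemma smooth_form_section2 E (w : ext_form E) (X Y : section E) :
  smooth_form w -> smooth_section X -> smooth_section Y ->
  smooth_fun setT (fun x => w x [:: X x; Y x]).
Proof.
move=> [wa ws] sX sY; apply: (@smooth_fun_frames E) => e Ee.
have oe := frame_open Ee.
apply: (@smooth_fun_ext _ _ _ _ (fun x => \sum_i coframe e i x (X x) *
  \sum_j coframe e j x (Y x) * w x [:: frame e i x; frame e j x])) => //.
  move=> x; rewrite inE => ex.
  rewrite [X in w x [:: X; _]](frame_sum _ Ee ex) alt_form2_suml//.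
  apply: eq_bigr => i _; congr (_ * _).
  by rewrite [X in w x [:: _; X]](frame_sum _ Ee ex) alt_form2_sumr.
apply: smooth_fun_sum => // i; apply: smooth_funM => //; first exact: sX.
apply: smooth_fun_sum => // j; apply: smooth_funM => //; first exact: sY.
exact: (ws e Ee [:: i; j]).
Qed.

Lemma ext_wedgeE E (w1 w2 : ext_form E) x s :
  ext_wedge w1 w2 x s = wedge_seq (w1 x) (w2 x) s.
Proof. by []. Qed.

Lemma wedge_form0l E f (w : ext_form E) :
  ext_wedge (form0 f) w = fun x s => f x * w x s.
Proof.
by apply: ext_formP => x s; exact: wedge_seq_suppl.
Qed.

Lemma wedge_form0r E f (w : ext_form E) :
  ext_wedge w (form0 f) = fun x s => w x s * f x.
Proof.
by apply: ext_formP => x s; exact: wedge_seq_suppr.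
Qed.

Definition bivector_of E (X Y : section E) : multivector E :=
  @form2 (dual_bundle E) (fun x (xi eta : 'Hom(E x, R^o)) =>
    xi (X x) * eta (Y x) - eta (X x) * xi (Y x)).

Lemma wedge_vector1 E (X Y : section E) :
  ext_wedge (vector1 X) (vector1 Y) = bivector_of X Y.
Proof.
apply: ext_formP => x [|u s]; rewrite ext_wedgeE.
  by rewrite wedge_seq_nil mul0r.
rewrite wedge_seq_cons wedge_seq_suppl// wedge_seq_suppr//= /parity_twist.
case: s => [|v [|? ?]] /=; rewrite ?mulr0 ?mul0r ?addr0 ?mul0r//.
by rewrite expr1 mulN1r mulNr.
Qed.

Lemma kform_bivector_of E (X Y : section E) :
  smooth_section X -> smooth_section Y -> kform 2 (bivector_of X Y).
Proof.
move=> sX sY; apply: kform_form2.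
- by move=> x a u v z; rewrite !add_lfunE !scale_lfunE ![_ *: _]mulrC; ring.
- by move=> x a u v z; rewrite !add_lfunE !scale_lfunE ![_ *: _]mulrC; ring.
- by move=> x u; rewrite subrr.
move=> _ [e Ee <-] i j /=; have oe := frame_open Ee.
rewrite (_ : (fun _ => _) = fun x =>
  coframe e i x (X x) * coframe e j x (Y x)
  + -1 * (coframe e j x (X x) * coframe e i x (Y x))); last first.
  by apply/funext => x; rewrite mulN1r.
apply: smooth_funD => //.
  by apply: smooth_funM => //; [exact: sX | exact: sY].
apply: smooth_funM => //; first exact: smooth_fun_cst.
by apply: smooth_funM => //; [exact: sX | exact: sY].
Qed.

Lemma wedge_form1_3 E (phi : section (dual_bundle E)) (w : ext_form E) x u v z :
  ext_wedge (form1 phi) w x [:: u; v; z]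
  = phi x u * w x [:: v; z] - phi x v * w x [:: u; z] + phi x z * w x [:: u; v].
Proof.
rewrite ext_wedgeE wedge_seq_cons wedge_seq_suppl//=.
rewrite wedge_seq_cons wedge_seq_suppl//=; last first.
  by move=> ? ?; rewrite /parity_twist /= mulr0.
rewrite wedge_seq_cons wedge_seq_suppl//=; last first.
  by move=> ? ?; rewrite /parity_twist /= !mulr0.
rewrite wedge_seq_nil /parity_twist /=; ring.
Qed.

End FormCalculus.

Arguments form2 {R n M r E} B x s.
Arguments bivector_of {R n M r E} X Y x s.


(** * Locality of the Schouten bracket *)

Section SchoutenLocal.
Context {R : realType} {n : nat} {M : manifold R n} {r : nat}.
Context {A : vector_bundle M r} {L : algebroid A}.
Context {S : multivector A -> multivector A -> multivector A}.
Hypothesis SP : schouten_bracket L S.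
Arguments S : clear implicits.
Implicit Types (D E : multivector A) (f g : M -> R) (x : M).

Lemma schouten_0r D : smooth_form D -> S D (fun _ _ => 0) = fun _ _ => 0.
Proof.
move=> sD; have [s0 _] := kform_cst0 (dual_bundle A) 0.
have := schouten_linear_r SP 1 sD s0 s0.
rewrite (_ : (fun _ _ => 1 * 0 + 0) = fun _ _ => 0); last first.
  by apply: ext_formP => x s; rewrite mulr0 addr0.
move=> S0; apply: ext_formP => x s.
have /eqP := congr1 (fun w => w x s) S0; rewrite mul1r -subr_eq0 opprD addNKr.
by rewrite oppr_eq0 => /eqP.
Qed.

Lemma schouten_sumr I (l : seq I) k D (E : I -> multivector A) :
  smooth_form D -> (forall i, kform k (E i)) ->
  S D (fun x s => \sum_(i <- l) E i x s)
  = fun x s => \sum_(i <- l) S D (E i) x s.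
Proof.
move=> sD kE; elim: l => [|i l IH].
  rewrite (_ : (fun _ _ => _) = fun _ _ => 0); last first.
    by apply: ext_formP => x s; rewrite big_nil.
  by rewrite schouten_0r//; apply: ext_formP => x s; rewrite big_nil.
rewrite (_ : (fun _ _ => _) =
    fun x s => 1 * E i x s + \sum_(j <- l) E j x s); last first.
  by apply: ext_formP => x s; rewrite big_cons mul1r.
rewrite (schouten_linear_r SP) ?IH//; last 2 first.
- by have [] := kE i.
- by have [] := kform_sum l kE.
by apply: ext_formP => x s; rewrite big_cons mul1r.
Qed.

Lemma schouten_scale a b D E f : kform a D -> kform b E -> smooth_fun setT f ->
  S D (fun x s => f x * E x s)
  = fun x s => ext_wedge (S D (form0 f)) E x s + f x * S D E x s.
Proof.
move=> kD kE sf; rewrite -wedge_form0l.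
rewrite (schouten_leibniz SP kD (kform0 _ sf) kE) muln0 wedge_form0l.
by apply: ext_formP => x s; rewrite expr0 mul1r.
Qed.

Lemma schouten_scaler a b D E f : kform a D -> kform b E -> smooth_fun setT f ->
  S D (fun x s => f x * E x s)
  = fun x s => S D E x s * f x
               + (-1) ^+ ((a + 1) * b) * ext_wedge E (S D (form0 f)) x s.
Proof.
move=> kD kE sf; rewrite (_ : (fun x s => _) = ext_wedge E (form0 f)).
  by rewrite (schouten_leibniz SP kD kE (kform0 _ sf)) wedge_form0r.
by rewrite wedge_form0r; apply: ext_formP => x s; rewrite mulrC.
Qed.

Lemma schouten_one a D : kform a D -> S D (form0 (fun=> 1)) = fun _ _ => 0.
Proof.
move=> kD; have s1 := @smooth_fun_cst R n M setT 1.
have := schouten_scale kD (kform0 (dual_bundle A) s1) s1.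
rewrite -wedge_form0l (_ : ext_wedge _ _ = form0 (fun=> 1)); last first.
  by rewrite wedge_form0l; apply: ext_formP => x s; rewrite mul1r.
move=> S1; apply: ext_formP => x s.
have /eqP := congr1 (fun w => w x s) S1.
by rewrite wedge_form0r mul1r mulr1 -subr_eq0 opprD addNKr oppr_eq0 => /eqP.
Qed.

Lemma smooth_unit_square g : smooth_fun setT g ->
  smooth_fun setT (fun x => 1 - (1 - g x) ^+ 2).
Proof.
move=> sg; have sc (a : R) := @smooth_fun_cst R n M setT a.
rewrite (_ : (fun _ => _) = fun x => g x * (2 + -1 * g x)).
  have oT := @openT M; apply: smooth_funM => //; apply: smooth_funD => //.
  exact: smooth_funM.
by apply/funext => x; ring.
Qed.

(* [S D] is a derivation and the square of [1 - g] vanishes to second order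
   at [x]. *)
Lemma schouten_unit_square a D g x s : kform a D -> smooth_fun setT g ->
  g x = 1 -> S D (form0 (fun y => 1 - (1 - g y) ^+ 2)) x s = 0.
Proof.
move=> kD sg gx; pose k y := 1 + -1 * g y.
have sc (c : R) := @smooth_fun_cst R n M setT c.
have oT := @openT M.
have sk : smooth_fun setT k.
  by apply: smooth_funD => //; apply: smooth_funM.
have k0 f := kform0 (dual_bundle A) (f := f).
rewrite (_ : form0 _ =
    fun y t => -1 * (k y * form0 k y t) + form0 (fun=> 1) y t).
  have kk : kform 0 ((fun y t => k y * form0 k y t) : multivector A).
    exact: kformZ sk (k0 _ sk).
  rewrite (schouten_linear_r SP (-1) kD.1 kk.1 (k0 _ (sc 1)).1).
  rewrite (schouten_one kD) (schouten_scale kD (k0 _ sk) sk) wedge_form0r.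
  by rewrite /k gx mulr1 subrr mulr0 mul0r !addr0 mulr0.
apply: ext_formP => y [|? ?] /=; first by rewrite /k; ring.
by rewrite !mulr0 addr0.
Qed.

Lemma schouten_local_r a b D E g x s : kform a D -> kform b E ->
  smooth_fun setT g -> g x = 1 ->
  S D (fun y t => (1 - (1 - g y) ^+ 2) * E y t) x s = S D E x s.
Proof.
move=> kD kE sg gx.
rewrite (schouten_scale kD kE (smooth_unit_square sg)) gx subrr expr0n subr0.
rewrite mul1r -[RHS]add0r; congr (_ + _).
apply: big1 => m _; rewrite (schouten_unit_square _ kD sg gx).
by rewrite mulr0 mul0r.
Qed.

Lemma schouten_local_l a b D E g x s : kform a D -> kform b E ->
  smooth_fun setT g -> g x = 1 ->
  S (fun y t => (1 - (1 - g y) ^+ 2) * D y t) E x s = S D E x s.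
Proof.
move=> kD kE sg gx; have kgD := kformZ (smooth_unit_square sg) kD.
rewrite (schouten_skew SP kgD kE) (schouten_skew SP kD kE).
by rewrite (schouten_local_r s kE kD sg gx).
Qed.

End SchoutenLocal.

Section LocalGeneration.
Context {R : realType} {n : nat} {M : manifold R n} {r : nat}.
Context {A : vector_bundle M r}.

(* If [h] is a bump function supported in the domain of a frame [e_i], then
   [g = h ^ 3] satisfies [g pi = sum_ij (h pi_ij / 2) (h e_i) /\ (h e_j)], whose
   terms are globally defined; finally [1 - (1 - g) ^ 2 = (2 - g) g]. *)
Lemma bivector_generation (pi : multivector A) (x : M) : kform 2 pi ->
  exists g (f : 'I_r * 'I_r -> M -> R) (E : 'I_r -> section A),
  [/\ smooth_fun setT g /\ g x = 1, forall p, smooth_fun setT (f p),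
      forall i, smooth_section (E i) &
      forall y s, (1 - (1 - g y) ^+ 2) * pi y s
        = \sum_p f p y * bivector_of (E p.1) (E p.2) y s].
Proof.
move=> kpi; have [[pia pis] pi2] := kpi.
have [e Ee ex] := frames_cover A x; have oe := frame_open Ee.
have [h [K [cK KU sh hx h0]]] := smooth_bump oe ex.
have oT := @openT M; have sc (c : R) := @smooth_fun_cst R n M setT c.
pose g y := h y * (h y * h y).
have sg : smooth_fun setT g by do 2 apply: smooth_funM => //.
pose q y := 2 + -1 * g y.
have sq : smooth_fun setT q by apply: smooth_funD => //; exact: smooth_funM.
pose f (p : 'I_r * 'I_r) y :=
  q y * (h y * (2^-1 * pi y [:: coframe e p.1 y; coframe e p.2 y])).
pose E i y := h y *: frame e i y.
exists g, f, E; split.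
- by rewrite /g hx !mul1r.
- move=> p; rewrite /f; apply: smooth_funM => //.
  apply: (smooth_fun_supp oe oT cK KU); last by move=> y /h0->; rewrite mul0r.
  rewrite setIT; apply: smooth_funM => //; first exact: smooth_fun_sub sh.
  apply: smooth_funM => //; first exact: smooth_fun_cst.
  have Ede : frames (dual_bundle A) (dual_frame e) by exists e.
  exact: (pis _ Ede [:: p.1; p.2]).
- move=> i e' Ee' j; have oe' := frame_open Ee'.
  apply: (smooth_fun_supp oe oe' cK KU); last first.
    by move=> y /h0 hy; rewrite /E hy scale0r linear0.
  have oI : open (frame_dom e `&` frame_dom e') by exact: openI.
  rewrite (_ : (fun _ => _) = fun y => h y * coframe e' j y (frame e i y)).
    apply: smooth_funM => //; first exact: smooth_fun_sub sh.
    exact: frames_transition.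
  by apply/funext => y; rewrite /E linearZ.
move=> y s; have [s2|] := eqVneq (size s) 2; last first.
  move=> s2; rewrite pi2// mulr0 big1// => p _.
  by case: s s2 => [|? [|? [|? ?]]]//=; rewrite mulr0.
case: s s2 => [|xi [|eta [|? ?]]]// _.
have [hy|hy] := eqVneq (h y) 0.
  rewrite big1; last by move=> p _; rewrite /f hy; ring.
  by rewrite /g hy; ring.
have ey : frame_dom e y.
  by apply: KU; apply: contrapT => /h0 /eqP; rewrite (negbTE hy).
have expand (z t : 'Hom(A y, R^o)) :
    \sum_i \sum_j (z (frame e i y) : R) * (t (frame e j y) : R)
                  * pi y [:: coframe e i y; coframe e j y] = pi y [:: z; t].
  rewrite [in RHS](coframe_sum z Ee ey) alt_form2_suml//.
  apply: eq_bigr => i _; rewrite [in RHS](coframe_sum t Ee ey) alt_form2_sumr//.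
  by rewrite mulr_sumr; apply: eq_bigr => j _; rewrite mulrA.
transitivity (q y * g y * 2^-1 * (pi y [:: xi; eta] - pi y [:: eta; xi])).
  by rewrite [pi y [:: eta; xi]]alt_form2C//; rewrite /q; field.
rewrite -(expand xi) -(expand eta) !pair_bigA -sumrB mulr_sumr.
apply: eq_bigr => -[i j] _ /=.
rewrite /f /E !linearZ /= ![_ *: _]mulrC /g; ring.
Qed.

End LocalGeneration.


(** * Pullback to M x R *)

Section Pullback.
Context {R : realType} {n : nat} {M : manifold R n} {r : nat}.
Context {A : vector_bundle M r}.

Definition pull_section (X : section A) : section (bundle_times_line A) :=
  fun p => X p.1.

Definition pull_form (w : ext_form A) : ext_form (bundle_times_line A) :=
  fun p s => w p.1 s.

Definition pull_multivector (D : multivector A) :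
    multivector (bundle_times_line A) := fun p s => D p.1 s.

Lemma smooth_fun_pull (f : M -> R) : smooth_fun setT f ->
  smooth_fun setT (fun p : times_line M => f p.1).
Proof.
move=> /smooth_fun_times_line; rewrite (_ : _ `*` _ = setT)//.
by apply/seteqP; split.
Qed.

Lemma smooth_fun_line (b : R -> R) : (forall k, Ck_on k setT b) ->
  smooth_fun setT (fun p : times_line M => b p.2).
Proof.
move=> Cb _ [c Ac <-] k; apply: (@Ck_on_sub _ _ _ setT) => //.
apply: (@Ck_on_lin _ _ _ (fun u : 'rV_(n + 1) => rsubmx u 0 0) k setT b) => //.
- by move=> a u v; rewrite !mxE.
- move=> u; exact: continuous_comp (@continuous_rsubmx _ _ _ _ u)
                                   (@coord_continuous _ _ _ 0 0 _).
Qed.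

Lemma smooth_fun_expR : smooth_fun setT (fun p : times_line M => expR p.2).
Proof. by apply: smooth_fun_line => k; exact: Ck_on_expR. Qed.

Lemma smooth_fun_expRN : smooth_fun setT (fun p : times_line M => expR (- p.2)).
Proof.
apply: (@smooth_fun_line (fun t => expR (- t))) => k.
apply: (@Ck_on_comp _ _ _ _ expR -%R); [exact: openT | exact: Ck_on_expR |].
rewrite (_ : -%R = cst (-1) \* id); last first.
  by apply/funext => t /=; rewrite mulN1r.
by apply: Ck_onM; [exact: openT | exact: Ck_on_cst | exact: Ck_on_id].
Qed.

Lemma smooth_section_pull (X : section A) :
  smooth_section X -> smooth_section (pull_section X).
Proof.
by move=> sX _ [e Ee <-] i; exact: smooth_fun_times_line (sX e Ee i).
Qed.

Lemma kform_pull k (w : ext_form A) : kform k w -> kform k (pull_form w).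
Proof.
move=> [[wa ws] wk]; split; last by move=> p s; exact: wk.
split=> [p|_ [e Ee <-] I]; first exact: wa.
exact: smooth_fun_times_line (ws e Ee I).
Qed.

Lemma kform_pull_multivector k (D : multivector A) :
  kform k D -> kform k (pull_multivector D).
Proof.
move=> [[Da Ds] Dk]; split; last by move=> p s; exact: Dk.
split=> [p|_ [_ [e Ee <-] <-] I]; first exact: Da.
have Ede : frames (dual_bundle A) (dual_frame e) by exists e.
exact: smooth_fun_times_line (Ds _ Ede I).
Qed.

Lemma kform_tilde_form k (w : ext_form A) : kform k w -> kform k (tilde_form w).
Proof. by move=> kw; exact: kformZ smooth_fun_expR (kform_pull kw). Qed.

Lemma kform_tilde_multivector k (D : multivector A) :
  kform k D -> kform k (tilde_multivector D).
Proof.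
by move=> kD; exact: kformZ smooth_fun_expRN (kform_pull_multivector kD).
Qed.

End Pullback.

Arguments pull_section {R n M r A} X x.
Arguments pull_form {R n M r A} w x s.
Arguments pull_multivector {R n M r A} D x s.

(** * The Schouten bracket on M x R *)

Section TildeSchouten.
Context {R : realType} {n : nat} {M : manifold R n} {r : nat}.
Context {A : vector_bundle M r} {L : algebroid A}.
Context {phi : section (dual_bundle A)}.
Context {S : multivector A -> multivector A -> multivector A}.
Context {T : multivector (bundle_times_line A) ->
             multivector (bundle_times_line A) ->
             multivector (bundle_times_line A)}.
Hypothesis SP : schouten_bracket L S.
Hypothesis TP : schouten_bracket (tilde_algebroid L phi) T.
Arguments S : clear implicits.
Arguments T : clear implicits.
Implicit Types (D E : multivector A) (f g : M -> R) (X Y : section A).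
Local Notation pull := pull_multivector.

Definition schouten_natural D E :=
  T (pull D) (pull E) = pull (S D E).

Lemma natural_sym a b D E : kform a D -> kform b E ->
  schouten_natural D E -> schouten_natural E D.
Proof.
move=> kD kE DE; have kpD := kform_pull_multivector kD.
have kpE := kform_pull_multivector kE.
rewrite /schouten_natural (schouten_skew TP kpE kpD) DE.
by rewrite (schouten_skew SP kE kD).
Qed.

Lemma natural_wedge a b c D E F : kform a D -> kform b E -> kform c F ->
  schouten_natural D E -> schouten_natural D F ->
  schouten_natural D (ext_wedge E F).
Proof.
move=> kD kE kF DE DF; have kpD := kform_pull_multivector kD.
have kpE := kform_pull_multivector kE; have kpF := kform_pull_multivector kF.
rewrite /schouten_natural (schouten_leibniz SP kD kE kF).
rewrite [LHS](schouten_leibniz TP kpD kpE kpF).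
by rewrite DE DF.
Qed.

Lemma natural_sum k I (l : seq I) D (E : I -> multivector A) :
  smooth_form D -> smooth_form (pull D) -> (forall i, kform k (E i)) ->
  (forall i, schouten_natural D (E i)) ->
  schouten_natural D (fun x s => \sum_(i <- l) E i x s).
Proof.
move=> sD spD kE DE; rewrite /schouten_natural (schouten_sumr SP l sD kE).
rewrite [LHS](schouten_sumr TP l spD (fun i => kform_pull_multivector (kE i))).
by apply: ext_formP => p s; apply: eq_bigr => i _; rewrite DE.
Qed.

Lemma natural_fun_fun f g : smooth_fun setT f -> smooth_fun setT g ->
  schouten_natural (form0 f) (form0 g).
Proof.
move=> sf sg; rewrite /schouten_natural (schouten_fun_fun SP sf sg).
exact: (schouten_fun_fun TP (smooth_fun_pull sf) (smooth_fun_pull sg)).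
Qed.

Lemma natural_section_fun X f : smooth_section X -> smooth_fun setT f ->
  schouten_natural (vector1 X) (form0 f).
Proof.
move=> sX sf; rewrite /schouten_natural (schouten_section_fun SP sX sf).
rewrite [LHS](schouten_section_fun TP (smooth_section_pull sX)
                                      (smooth_fun_pull sf)).
apply: ext_formP => p [|? ?]//=.
by rewrite derive1_cst mulr0 addr0.
Qed.

Lemma time_derivative_pull X p : time_derivative (pull_section X) p = 0.
Proof.
apply: big1 => i _.
rewrite (_ : (fun t => _) = cst (coord (vbasis fullv) i (X p.1)))//.
by rewrite derive1_cst scale0r.
Qed.

Lemma natural_section_section X Y : smooth_section X -> smooth_section Y ->
  schouten_natural (vector1 X) (vector1 Y).
Proof.
move=> sX sY; rewrite /schouten_natural (schouten_section_section SP sX sY).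
rewrite [LHS](schouten_section_section TP (smooth_section_pull sX)
                                          (smooth_section_pull sY)).
apply: ext_formP => p [|xi [|? ?]]//=.
by rewrite !time_derivative_pull !scaler0 subr0 addr0.
Qed.

Definition natural_on_generators D :=
  (forall f, smooth_fun setT f -> schouten_natural D (form0 f)) /\
  (forall X, smooth_section X -> schouten_natural D (vector1 X)).

Lemma scale_wedge f E :
  (fun x s => f x * E x s) = ext_wedge (form0 f) E.
Proof. by rewrite wedge_form0l. Qed.

Lemma kform_generated f X Y :
  smooth_fun setT f -> smooth_section X -> smooth_section Y ->
  kform 2 (fun x s => f x * bivector_of X Y x s).
Proof. by move=> sf sX sY; apply: kformZ => //; exact: kform_bivector_of. Qed.

Lemma natural_generated a D f X Y : kform a D -> natural_on_generators D ->
  smooth_fun setT f -> smooth_section X -> smooth_section Y ->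
  schouten_natural D (fun x s => f x * bivector_of X Y x s).
Proof.
move=> kD [Df DX] sf sX sY; rewrite scale_wedge.
apply: (natural_wedge kD (kform0 _ sf) (kform_bivector_of sX sY)).
  exact: Df.
rewrite -wedge_vector1.
by apply: (natural_wedge kD (kform_vector1 sX) (kform_vector1 sY)); exact: DX.
Qed.

Lemma natural_fun f : smooth_fun setT f -> natural_on_generators (form0 f).
Proof.
move=> sf; split=> [g sg|X sX]; first exact: natural_fun_fun.
apply: natural_sym (kform_vector1 sX) (kform0 _ sf) _.
exact: natural_section_fun.
Qed.

Lemma natural_section X : smooth_section X -> natural_on_generators (vector1 X).
Proof.
move=> sX; split=> [f sf|Y sY]; first exact: natural_section_fun.
exact: natural_section_section.
Qed.

Lemma natural_bivector D E : kform 2 D -> kform 2 E -> schouten_natural D E.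
Proof.
move=> kD kE; apply: ext_formP => -[x t] s.
have [g [f [X [[sg gx] sf sX gD]]]] := bivector_generation x kD.
have [h [k [Y [[sh hx] sk sY hE]]]] := bivector_generation x kE.
have kpD := kform_pull_multivector kD; have kpE := kform_pull_multivector kE.
have spg := smooth_fun_pull sg; have sph := smooth_fun_pull sh.
rewrite /pull/= -(schouten_local_l SP s kD kE sg gx).
have kgD := kformZ (smooth_unit_square sg) kD.
have kpgD := kform_pull_multivector kgD.
rewrite -(schouten_local_r SP s kgD kE sh hx).
rewrite -(@schouten_local_l _ _ _ _ _ _ _ TP _ _ _ _ _ (x, t) s kpD kpE spg gx).
rewrite -(@schouten_local_r _ _ _ _ _ _ _ TP _ _ _ _ _ (x, t) s
            kpgD kpE sph hx).
pose sD : multivector A :=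
  fun y s => \sum_p f p y * bivector_of (X p.1) (X p.2) y s.
have {}gD : (fun y s => (1 - (1 - g y) ^+ 2) * D y s) = sD.
  exact: ext_formP.
pose sE : multivector A :=
  fun y s => \sum_p k p y * bivector_of (Y p.1) (Y p.2) y s.
have {}hE : (fun y s => (1 - (1 - h y) ^+ 2) * E y s) = sE.
  exact: ext_formP.
rewrite -[RHS]/(pull (S _ _) (x, t) s).
rewrite -[LHS]/(T (pull (fun y s => (1 - (1 - g y) ^+ 2) * D y s))
                  (pull (fun y s => (1 - (1 - h y) ^+ 2) * E y s)) (x, t) s).
rewrite gD in kgD kpgD *; rewrite hE.
suff -> : T (pull sD) (pull sE) = pull (S sD sE) by [].
have nat_gD F b : kform b F -> natural_on_generators F -> schouten_natural sD F.
  move=> kF nF; apply: (natural_sym kF kgD).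
  have kpF := kform_pull_multivector kF.
  apply: (@natural_sum 2 _ _ F _ kF.1 kpF.1) => p.
    exact: kform_generated.
  exact: natural_generated kF nF _ _ _.
apply: (@natural_sum 2 _ _ _ _ kgD.1 kpgD.1) => p; first exact: kform_generated.
apply: (natural_generated kgD) => //; split=> [u su|Z sZ].
  exact: nat_gD (kform0 _ su) (natural_fun su).
exact: nat_gD (kform_vector1 sZ) (natural_section sZ).
Qed.

Hypothesis anchorP : forall x v, tangent_vector x (anchor L x v).

Lemma anchor_cst x v (c : R) : anchor L x v (fun=> c) = 0.
Proof.
have s1 := @smooth_fun_cst R n M setT 1.
have [lin mul] := anchorP v s1 s1.
have v1 : anchor L x v (fun=> 1) = 0.
  move/eqP: mul; rewrite mulr1 mul1r -subr_eq0 opprD addNKr oppr_eq0.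
  by move/eqP.
have := lin (c - 1); rewrite v1 mulr0 addr0 => <-.
by congr (anchor L x v); apply/funext => y; ring.
Qed.

Local Notation expN := (fun p : times_line M => expR (- p.2)).

Lemma schouten_section_exp X : smooth_section X ->
  T (pull (vector1 X)) (form0 expN)
  = form0 (fun p : times_line M => - (phi p.1 (X p.1) : R) * expR (- p.2)).
Proof.
move=> sX.
rewrite [LHS](schouten_section_fun TP (smooth_section_pull sX)
                                      (smooth_fun_expRN (M := M))).
apply: ext_formP => p [|? ?]//=; rewrite anchor_cst add0r.
have dN : is_derive p.2 1 (fun t : R => - t) (-1) by apply: is_deriveN.
have [_ dE] := @is_derive1_comp R expR -%R p.2 _ _ (is_derive_expR _) dN.
by rewrite derive1E [X in _ * X]dE mulrN1 mulrN mulNr.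
Qed.

Lemma schouten_exp_section X : smooth_section X ->
  T (form0 expN) (pull (vector1 X))
  = form0 (fun p : times_line M => (phi p.1 (X p.1) : R) * expR (- p.2)).
Proof.
move=> sX; have sE := smooth_fun_expRN (M := M).
have kX := kform_vector1 (smooth_section_pull sX).
rewrite (schouten_skew TP (kform0 _ sE) kX).
rewrite [T _ _](schouten_section_exp sX).
by apply: ext_formP => p [|? ?] /=; ring.
Qed.

Lemma schouten_exp_bivector_of X Y : smooth_section X -> smooth_section Y ->
  T (form0 expN) (pull (bivector_of X Y))
  = fun p s => expR (- p.2) * bivector_of X Y p.1 (phi p.1 :: s).
Proof.
move=> sX sY; have sE := smooth_fun_expRN (M := M).
have kX := kform_pull_multivector (kform_vector1 sX).
have kY := kform_pull_multivector (kform_vector1 sY).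
rewrite -wedge_vector1 [LHS](schouten_leibniz TP (kform0 _ sE) kX kY).
rewrite !schouten_exp_section// wedge_form0l wedge_form0r wedge_vector1.
by apply: ext_formP => p [|eta [|? ?]]; rewrite /pull /=; ring.
Qed.

Lemma schouten_bivector_exp D : kform 2 D ->
  T (form0 expN) (pull D)
  = fun p s => expR (- p.2) * int_product phi D p.1 s.
Proof.
move=> kD; apply: ext_formP => -[x t] s.
have [g [f [X [[sg gx] sf sX gD]]]] := bivector_generation x kD.
have kpD := kform_pull_multivector kD; have spg := smooth_fun_pull sg.
have sE := smooth_fun_expRN (M := M).
have kE := kform0 (dual_bundle (bundle_times_line A)) sE.
rewrite -(@schouten_local_r _ _ _ _ _ _ _ TP _ _ _ _ _ (x, t) s kE kpD spg gx).
have pgD : (fun (y : times_line M) u => (1 - (1 - g y.1) ^+ 2) * pull D y u)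
    = fun y u => \sum_p f p y.1 * pull (bivector_of (X p.1) (X p.2)) y u.
  by apply: ext_formP => y u; exact: gD.
rewrite pgD.
have kXX p := kform_pull_multivector (kform_bivector_of (sX p.1) (sX p.2)).
have kfX p := kformZ (smooth_fun_pull (sf p)) (kXX p).
rewrite (schouten_sumr TP _ kE.1 kfX).
have gDphi : D x (phi x :: s)
    = \sum_p f p x * bivector_of (X p.1) (X p.2) x (phi x :: s).
  by rewrite -gD gx subrr expr0n subr0 mul1r.
rewrite /int_product/= gDphi mulr_sumr.
apply: eq_bigr => p _; have spf := smooth_fun_pull (sf p).
rewrite (schouten_scale TP kE (kXX p) spf) (schouten_fun_fun TP sE spf).
rewrite wedge_form0l mul0r add0r.
by rewrite schouten_exp_bivector_of//= mulrCA.
Qed.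

Lemma schouten_tilde_multivector D : kform 2 D ->
  T (tilde_multivector D) (tilde_multivector D)
  = fun p s => expR (- p.2) ^+ 2 * jacobi_bracket (x := p.1) S phi 2 2 D D s.
Proof.
move=> kD; have kpD := kform_pull_multivector kD.
have ktD := kform_tilde_multivector kD.
have sE := smooth_fun_expRN (M := M).
have kE := kform0 (dual_bundle (bundle_times_line A)) sE.
have T1 : T (form0 expN) (tilde_multivector D)
    = fun p s => expR (- p.2) ^+ 2 * int_product phi D p.1 s.
  rewrite [LHS](schouten_scale TP kE kpD sE) (schouten_fun_fun TP sE sE).
  rewrite wedge_form0l schouten_bivector_exp//.
  by apply: ext_formP => p s; ring.
have T2 : T (tilde_multivector D) (form0 expN)
    = fun p s => expR (- p.2) ^+ 2 * int_product phi D p.1 s.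
  by rewrite (schouten_skew TP ktD kE) T1; apply: ext_formP => p s; ring.
have T3 : T (pull D) (form0 expN)
    = fun p s => expR (- p.2) * int_product phi D p.1 s.
  rewrite (schouten_skew TP kpD kE) schouten_bivector_exp//.
  by apply: ext_formP => p s; ring.
have T4 : T (tilde_multivector D) (pull D) = T (pull D) (tilde_multivector D).
  by rewrite (schouten_skew TP ktD kpD); apply: ext_formP => p s; ring.
rewrite [LHS](schouten_scaler TP ktD kpD sE) T2 T4.
rewrite (schouten_scale TP kpD kpD sE) T3 (natural_bivector kD kD).
apply: ext_formP => p s; rewrite /jacobi_bracket.
rewrite (_ : ext_wedge _ (pull D) p s
  = expR (- p.2) * ext_wedge (int_product phi D) D p.1 s); last first.
  by rewrite /ext_wedge mulr_sumr; apply: eq_bigr => m _; rewrite /pull; ring.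
rewrite (_ : ext_wedge (pull D) _ p s
  = expR (- p.2) ^+ 2 * ext_wedge D (int_product phi D) p.1 s); last first.
  by rewrite /ext_wedge mulr_sumr; apply: eq_bigr => m _; rewrite /pull; ring.
by rewrite /pull; ring.
Qed.

Lemma jacobi_structure_tilde D : kform 2 D ->
  jacobi_structure S phi D <-> poisson_structure T (tilde_multivector D).
Proof.
move=> kD; have ktD := kform_tilde_multivector kD.
rewrite /poisson_structure schouten_tilde_multivector//.
split=> -[_ D0]; split=> //.
  by rewrite D0; apply: ext_formP => p s; rewrite mulr0.
apply: ext_formP => x s.
have /eqP := congr1 (fun w : multivector (bundle_times_line A) => w (x, 0) s) D0.
by rewrite mulf_eq0 expf_eq0/= gt_eqF ?expR_gt0//= => /eqP.
Qed.

End TildeSchouten.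


(** * The differential on M x R *)

Section Slices.
Context {R : realType} {n : nat} {M : manifold R n} {r : nat}.
Context {A : vector_bundle M r}.
Implicit Types (F : times_line M -> R) (U : set M).
Implicit Types X Y : section (bundle_times_line A).

Lemma Ck_on_times_line U F c k : atlas M c ->
  smooth_fun (U `*` setT : set (times_line M)) F ->
  Ck_on k [set u : 'rV[R]_(n + 1) | (c @` (chart_dom c `&` U)) (lsubmx u)]
    (fun u => F (chart_inv c (lsubmx u), rsubmx u 0 0)).
Proof.
move=> Ac sF; have Atc : atlas (times_line M) (chart_times_line c) by exists c.
have := sF _ Atc k; rewrite [X in Ck_on k X](_ : _ =
  chart_times_line c @` ((chart_dom c `&` U) `*` setT)).
  by rewrite chart_times_line_image.
by congr image; apply/seteqP; split=> [p [[? _] [? _]]|p [[? ?] _]].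
Qed.

Lemma continuous_row_mx0r (m : nat) :
  continuous (fun u : 'rV[R]_n => row_mx u (0 : 'rV[R]_m)).
Proof.
move=> u B [P nP PB].
exists (fun i j => P i (lshift m j)) => [i j|v uv].
  by have := nP i (lshift m j); rewrite row_mxEl.
apply: PB => i j; case: (split_ordP j) => k ->; first by rewrite row_mxEl.
by have := nbhs_singleton (nP i (rshift n k)); rewrite !row_mxEr.
Qed.

Lemma continuous_row_mx0l (m : nat) :
  continuous (fun t : R => row_mx (0 : 'rV[R]_m) (\row_(_ < 1) t)).
Proof.
move=> t B [P nP PB].
have nt : nbhs t (P 0 (rshift m 0)).
  by have := nP 0 (rshift m 0); rewrite row_mxEr mxE.
rewrite nbhs_simpl /=.
apply: (@filterS _ (nbhs t) _ (P 0 (rshift m 0))) nt => s Ps.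
apply: PB => i j; rewrite ord1; case: (split_ordP j) => k ->.
  by have := nbhs_singleton (nP 0 (lshift 1 k)); rewrite !row_mxEl.
by rewrite ord1 row_mxEr mxE.
Qed.

Lemma smooth_fun_slice U F t : smooth_fun (U `*` setT : set (times_line M)) F ->
  smooth_fun U (fun x => F (x, t)).
Proof.
move=> sF c Ac k; have CF := Ck_on_times_line k Ac sF.
pose l (u : 'rV[R]_n) := row_mx u (0 : 'rV[R]_1).
pose b : 'rV[R]_(n + 1) := row_mx 0 (\row__ t).
have lb u : l u + b = row_mx u (\row__ t).
  by rewrite /l /b add_row_mx addr0 add0r.
have ll : linear l.
  by move=> a u v; rewrite /l scale_row_mx add_row_mx scaler0 addr0.
have := Ck_on_affine b ll (@continuous_row_mx0r 1) CF.
rewrite (_ : [set u | _] = c @` (chart_dom c `&` U)); last first.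
  by apply/seteqP; split=> u /=; rewrite lb row_mxKl.
rewrite (_ : (fun u => _) = fun u => F (chart_inv c u, t))//.
by apply/funext => u; rewrite lb row_mxKl row_mxKr mxE.
Qed.

Lemma derivable_time U F x t :
  smooth_fun (U `*` setT : set (times_line M)) F -> U x ->
  derivable (fun s => F (x, s)) t 1.
Proof.
move=> sF Ux; have [c Ac dx] := atlas_cover x.
have CF := Ck_on_times_line 1 Ac sF; have [_ _ cK _ _] := atlas_chart Ac.
pose l (s : R) := row_mx (0 : 'rV[R]_n) (\row_(_ < 1) s).
pose b : 'rV[R]_(n + 1) := row_mx (c x) 0.
have lb s : l s + b = row_mx (c x) (\row__ s).
  by rewrite /l /b add_row_mx addr0 add0r.
have ll : linear l.
  move=> a u v; rewrite /l scale_row_mx add_row_mx scaler0 addr0; congr row_mx.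
  by apply/rowP => i; rewrite !mxE.
have [_ /(_ 1)[dF _]] := Ck_on_affine b ll (@continuous_row_mx0l n) CF.
have := dF t; rewrite /= lb row_mxKl.
rewrite (_ : (fun u => _) = fun s => F (x, s)); first by apply; exists x.
by apply/funext => s; rewrite lb row_mxKl row_mxKr mxE cK.
Qed.

Lemma smooth_section_slice X t :
  smooth_section X -> smooth_section (time_slice X t).
Proof.
move=> sX e Ee i.
have Ete : frames (bundle_times_line A) (frame_times_line e) by exists e.
exact: smooth_fun_slice (sX _ Ete i).
Qed.

Lemma is_derive_functional X x (t : R) (xi : 'Hom(A x, R^o)) :
  smooth_section X ->
  is_derive t 1 (fun s => xi (X (x, s)) : R) (xi (time_derivative X (x, t))).
Proof.
move=> sX.
have dX (eta : 'Hom(A x, R^o)) : derivable (fun s => eta (X (x, s)) : R) t 1.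
  have [e Ee ex] := frames_cover A x.
  have Ete : frames (bundle_times_line A) (frame_times_line e) by exists e.
  rewrite (_ : (fun s => _) = \sum_(i < r)
    ((fun s : R => (coframe e i x (X (x, s)) : R)) * cst (eta (frame e i x)))).
    apply: derivable_sum => i; apply: derivableM; last exact: derivable_cst.
    exact: derivable_time (sX _ Ete i) ex.
  apply/funext => s; rewrite {1}(@frame_sum _ _ _ _ A _ _ (X (x, s)) Ee ex).
  rewrite linear_sum fct_sumE.
  by apply: eq_bigr => i _; rewrite linearZ.
pose d := \dim (fullv : {vspace A x}).
pose co i := coord (vbasis (fullv : {vspace A x})) i.
have dco (i : 'I_d) : is_derive t 1 (fun s => co i (X (x, s)) : R)
    (derive1 (fun s => co i (X (x, s)) : R) t).
  rewrite derive1E; apply: derivableP.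
  have := dX (linfun (co i : A x -> R^o)).
  rewrite (_ : (fun s => _) = (fun s => co i (X (x, s)) : R))//.
  by apply/funext => s; rewrite lfunE.
have := @is_derive_sum R R R d
  (fun i => (fun s => co i (X (x, s)) : R) * cst (xi (vbasis fullv)`_i)) t 1 _
  (fun i => is_deriveM (dco i) (is_derive_cst (xi (vbasis fullv)`_i : R) t 1)).
rewrite (_ : \sum_(i < d) _ = (fun s => xi (X (x, s)) : R)); last first.
  apply/funext => s; rewrite fct_sumE [in RHS](coord_vbasis (memvf (X (x, s)))).
  by rewrite linear_sum; apply: eq_bigr => i _; rewrite linearZ.
move/is_derive_eq; apply; rewrite linear_sum; apply: eq_bigr => i _.
rewrite linearZ /= scaler0 add0r; exact: mulrC.
Qed.

Lemma is_derive_form2 (w : ext_form A) X Y x (t : R) : alternating_form (w x) ->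
  smooth_section X -> smooth_section Y ->
  is_derive t 1 (fun s => w x [:: X (x, s); Y (x, s)])
    (w x [:: time_derivative X (x, t); Y (x, t)]
     + w x [:: X (x, t); time_derivative Y (x, t)]).
Proof.
move=> wa sX sY.
pose d := \dim (fullv : {vspace A x}).
pose co (i : 'I_d) : 'Hom(A x, R^o) :=
  linfun (coord (vbasis (fullv : {vspace A x})) i : A x -> R^o).
pose fl (i : 'I_d) := form_flat w ((vbasis fullv)`_i : A x).
have wE u v : w x [:: u; v] = \sum_(i < d) (co i u : R) * fl i v.
  rewrite [in LHS](coord_vbasis (memvf u)) alt_form2_suml//.
  by apply: eq_bigr => i _; rewrite /fl form_flatP// lfunE.
have := @is_derive_sum R R R d
  (fun i => (fun s => co i (X (x, s)) : R) * (fun s => fl i (Y (x, s)) : R))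
  t 1 _
  (fun i => is_deriveM (is_derive_functional t (co i) sX)
                       (is_derive_functional t (fl i) sY)).
rewrite (_ : \sum_(i < d) _ = (fun s => w x [:: X (x, s); Y (x, s)]));
    last first.
  by apply/funext => s; rewrite fct_sumE wE.
move/is_derive_eq; apply; rewrite !wE -big_split; apply: eq_bigr => i _ /=.
by rewrite addrC; congr (_ + _); exact: mulrC.
Qed.

End Slices.


Local Notation i0 := (@ord0 2).
Local Notation i1 := (lift ord0 (@ord0 1)).
Local Notation i2 := (lift ord0 (lift ord0 (@ord0 0))).

Section Differential.
Context {R : realType} {n : nat} {M : manifold R n} {r : nat}.

Lemma enum_ord3 : enum 'I_3 = [:: i0; i1; i2].
Proof. by rewrite !enum_ordSl /= (size0nil (size_enum_ord 0)). Qed.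

Lemma algebroid_d2E (A : vector_bundle M r) (L : algebroid A) (w : ext_form A)
    (X : 'I_3 -> section A) x :
  algebroid_d L w X x =
    anchor L x (X i0 x) (fun y => w y [:: X i1 y; X i2 y])
    - anchor L x (X i1 x) (fun y => w y [:: X i0 y; X i2 y])
    + anchor L x (X i2 x) (fun y => w y [:: X i0 y; X i1 y])
    - w x [:: bracket L (X i0) (X i1) x; X i2 x]
    + w x [:: bracket L (X i0) (X i2) x; X i1 x]
    - w x [:: bracket L (X i1) (X i2) x; X i0 x].
Proof.
rewrite /algebroid_d !enum_ord3.
under [X in _ + X]eq_bigr do rewrite big_mkcond.
rewrite !big_ord_recl !big_ord0 /=.
rewrite /bump /=; ring.
Qed.

Lemma jacobi_d2E (A : vector_bundle M r) (L : algebroid A)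
    (phi : section (dual_bundle A)) (w : ext_form A) (X : 'I_3 -> section A) x :
  jacobi_d L phi w X x = algebroid_d L w X x
    + (phi x (X i0 x) * w x [:: X i1 x; X i2 x]
       - phi x (X i1 x) * w x [:: X i0 x; X i2 x]
       + phi x (X i2 x) * w x [:: X i0 x; X i1 x]).
Proof. by rewrite /jacobi_d enum_ord3 /= wedge_form1_3. Qed.

End Differential.

Section TildeDifferential.
Context {R : realType} {n : nat} {M : manifold R n} {r : nat}.
Context {A : vector_bundle M r} {L : algebroid A}.
Context {phi : section (dual_bundle A)}.
Hypothesis anchorP : forall x v, tangent_vector x (anchor L x v).
Implicit Types (X Y Z : section (bundle_times_line A)) (w : ext_form A).

Lemma anchor_scale x v (a : R) (f : M -> R) : smooth_fun setT f ->
  anchor L x v (fun y => a * f y) = a * anchor L x v f.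
Proof.
move=> sf; have s0 := @smooth_fun_cst R n M setT 0.
have [lin _] := anchorP v sf s0.
rewrite -[RHS]addr0 -(anchor_cst anchorP v 0) -lin.
by congr (anchor L x v); apply/funext => y; rewrite addr0.
Qed.

Lemma tilde_anchor_form w Z X Y x t : kform 2 w ->
  smooth_section X -> smooth_section Y ->
  anchor (tilde_algebroid L phi) (x, t) (Z (x, t))
    (fun q => tilde_form w [:: X q; Y q])
  = expR t * (anchor L x (Z (x, t)) (fun y => w y [:: X (y, t); Y (y, t)])
      + phi x (Z (x, t)) * (w x [:: X (x, t); Y (x, t)]
        + w x [:: time_derivative X (x, t); Y (x, t)]
        + w x [:: X (x, t); time_derivative Y (x, t)])).
Proof.
move=> [[wa ws] _] sX sY; rewrite /tilde_form /= anchor_scale; last first.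
  exact: (smooth_form_section2 (conj wa ws) (smooth_section_slice t sX)
                               (smooth_section_slice t sY)).
have dw := is_derive_form2 t (wa x) sX sY.
have [_ dE] := is_deriveM (is_derive_expR t) dw.
rewrite derive1E [X in _ + _ * X]dE ![_ *: _]mulrC; ring.
Qed.

Lemma tilde_bracket_form w X Y Z x t : kform 2 w ->
  tilde_form (x := (x, t)) w
    [:: bracket (tilde_algebroid L phi) X Y (x, t); Z (x, t)]
  = expR t * (w x [:: bracket L (time_slice X t) (time_slice Y t) x; Z (x, t)]
              + phi x (X (x, t)) * w x [:: time_derivative Y (x, t); Z (x, t)]
              - phi x (Y (x, t)) * w x [:: time_derivative X (x, t); Z (x, t)]).
Proof.
move=> [[wa _] _]; rewrite /tilde_form /=; congr (_ * _).
rewrite addrC -scaleNr (alt_form2Dl (wa x)) addrC mulNr; congr (_ - _).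
by rewrite addrC (alt_form2Dl (wa x)) addrC.
Qed.

Lemma tilde_d w (X : 'I_3 -> section (bundle_times_line A)) x t : kform 2 w ->
  (forall i, smooth_section (X i)) ->
  algebroid_d (tilde_algebroid L phi) (tilde_form w) X (x, t)
  = expR t * jacobi_d L phi w (fun i => time_slice (X i) t) x.
Proof.
move=> kw sX; have [[wa _] _] := kw.
rewrite [LHS]algebroid_d2E jacobi_d2E algebroid_d2E.
rewrite !tilde_bracket_form// !tilde_anchor_form//.
rewrite (alt_form2C (wa x) (time_derivative (X i2) (x, t)) (X i1 (x, t))).
rewrite (alt_form2C (wa x) (time_derivative (X i2) (x, t)) (X i0 (x, t))).
rewrite (alt_form2C (wa x) (time_derivative (X i1) (x, t)) (X i0 (x, t))).
rewrite /time_slice; ring.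
Qed.

Lemma jacobi_d_closed_tilde w : kform 2 w ->
  jacobi_d_closed L phi 2 w <->
  d_closed (tilde_algebroid L phi) 2 (tilde_form w).
Proof.
move=> kw; split=> [dw X sX [x t]|dw X sX x].
  by rewrite tilde_d// dw ?mulr0// => i; exact: smooth_section_slice.
have := dw _ (fun i => smooth_section_pull (sX i)) (x, 0).
rewrite tilde_d//; last by move=> i; exact: smooth_section_pull.
by rewrite /= expR0 mul1r.
Qed.

End TildeDifferential.

(** * The form omega_N *)

Section FormN.
Context {R : realType} {n : nat} {M : manifold R n} {r : nat}.
Implicit Types (A : vector_bundle M r).

Lemma form_NE A (pi : multivector A) (w : ext_form A) x (u v : A x) :
  alternating_form (pi x) -> alternating_form (w x) ->
  form_N pi w [:: u; v] = - pi x [:: form_flat w u; form_flat w v].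
Proof.
move=> pia wa; rewrite /form_N form_flatP// alt_form2C// -form_flatP//.
rewrite /recursion_op bivector_sharpP//.
Qed.

Lemma form_flat_linear A (w : ext_form A) x a (u v : A x) :
  alternating_form (w x) ->
  form_flat w (a *: u + v) = a *: form_flat w u + form_flat w v.
Proof.
move=> wa; apply/lfunP => z; rewrite add_lfunE scale_lfunE !form_flatP//.
exact: alt_form2Dl.
Qed.

Lemma form_N_form2 A (pi : multivector A) (w : ext_form A) :
  smooth_form pi -> smooth_form w ->
  form_N pi w = form2 (fun x u v => - pi x [:: form_flat w u; form_flat w v]).
Proof.
move=> [pia _] [wa _]; apply: ext_formP => x [|u [|v [|? ?]]]//.
exact: form_NE.
Qed.

Lemma kform_form_N A (pi : multivector A) (w : ext_form A) :
  smooth_form pi -> smooth_form w -> kform 2 (form_N pi w).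
Proof.
move=> sp sw; rewrite form_N_form2//; have [[pia ps] [wa ws]] := (sp, sw).
apply: kform_form2.
- by move=> x a u v z; rewrite form_flat_linear// alt_form2Dl// opprD mulrN.
- by move=> x a u v z; rewrite form_flat_linear// alt_form2Dr// opprD mulrN.
- by move=> x u; rewrite alt_form2_diag// oppr0.
move=> e Ee i j; have oe := frame_open Ee.
have Ede : frames (dual_bundle A) (dual_frame e) by exists e.
apply: (@smooth_fun_ext _ _ _ _ (fun x => -1 * \sum_k
    w x [:: frame e i x; frame e k x] * \sum_l
    w x [:: frame e j x; frame e l x]
    * pi x [:: coframe e k x; coframe e l x])) => //.
  move=> x; rewrite inE => ex; rewrite mulN1r; congr (- _).
  rewrite [X in pi x [:: X; _]](coframe_sum _ Ee ex) alt_form2_suml//.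
  apply: eq_bigr => k _; rewrite form_flatP//; congr (_ * _).
  rewrite [X in pi x [:: _; X]](coframe_sum _ Ee ex) alt_form2_sumr//.
  by apply: eq_bigr => l _; rewrite form_flatP.
apply: smooth_funM => //; first exact: smooth_fun_cst.
apply: smooth_fun_sum => // k; apply: smooth_funM => //.
  exact: (ws _ Ee [:: i; k]).
apply: smooth_fun_sum => // l; apply: smooth_funM => //.
  exact: (ws _ Ee [:: j; l]).
exact: (ps _ Ede [:: k; l]).
Qed.

End FormN.

Lemma form_N_tilde (R : realType) n (M : manifold R n) r (A : vector_bundle M r)
    (pi : multivector A) (w : ext_form A) :
  kform 2 pi -> kform 2 w ->
  form_N (tilde_multivector pi) (tilde_form w) = tilde_form (form_N pi w).
Proof.
move=> kp kw; have [[[pia _] _] [[wa _] _]] := (kp, kw).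
have ktp := kform_tilde_multivector kp; have ktw := kform_tilde_form kw.
have [[[tpa _] _] [[twa _] _]] := (ktp, ktw).
rewrite (form_N_form2 kp.1 kw.1) (form_N_form2 ktp.1 ktw.1).
apply: ext_formP => p [|u [|v [|? ?]]]; rewrite /tilde_form /= ?mulr0//.
have flatE (z : A p.1) : form_flat (tilde_form w) (z : bundle_times_line A p)
    = expR p.2 *: form_flat w z.
  apply/lfunP => y.
  by rewrite scale_lfunE (form_flatP _ _ (twa p)) (form_flatP _ _ (wa p.1)).
rewrite !flatE /tilde_multivector alt_form2Zl// alt_form2Zr//.
by rewrite mulrN [X in - X]mulrA -expRD addNr expR0 mul1r.
Qed.

Theorem proposition4p4 (R : realType) (n : nat) (M : manifold R n) (r : nat)
    (A : vector_bundle M r) (L : algebroid A) (phi0 : section (dual_bundle A))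
    (schoutenA : multivector A -> multivector A -> multivector A)
    (schoutenT : multivector (bundle_times_line A) ->
                 multivector (bundle_times_line A) ->
                 multivector (bundle_times_line A))
    (pi : multivector A) (omega : ext_form A)
    (jacobiA : jacobi_algebroid L phi0)
    (schoutenAP : schouten_bracket L schoutenA)
    (schoutenTP : schouten_bracket (tilde_algebroid L phi0) schoutenT)
    (pi2 : kform 2 pi) (omega2 : kform 2 omega) :
  JOmega_structure L schoutenA phi0 pi omega <->
  POmega_structure (tilde_algebroid L phi0) schoutenT
    (tilde_multivector pi) (tilde_form omega).
Proof.
have [[_ _ _ _ anchorP _ _ _] _ _] := jacobiA.
have kN := kform_form_N pi2.1 omega2.1.
have jacobiP := jacobi_structure_tilde schoutenAP schoutenTP anchorP pi2.
have omegaP := jacobi_d_closed_tilde anchorP (phi := phi0) omega2.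
have omegaNP := jacobi_d_closed_tilde anchorP (phi := phi0) kN.
have ktomega := kform_tilde_form omega2.
rewrite /POmega_structure form_N_tilde//.
by split=> -[/jacobiP ? _ /omegaP ? /omegaNP ?]; split.
Qed.
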